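(* For every $p \in (1,\infty)$ there exist finite constants $S_p, T_p$ (depending only on $p$) such that for every integer $d\geq 1$ and every $f \in \mathcal{P}^{\geq d}$ on $\mathbb{R}$, $$\sqrt{d}\,\|f\|_{L^p(d\gamma_1)} \leq S_p\, \|f'\|_{L^p(d\gamma_1)} \quad\text{and}\quad d\,\|f\|_{L^p(d\gamma_1)} \leq T_p\, \|Lf\|_{L^p(d\gamma_1)}.$$
   Context: $d\gamma_1(x) = (2\pi)^{-1/2} e^{-x^2/2}\,dx$ is the standard Gaussian measure on $\mathbb{R}$, and $\|f\|_{L^p(d\gamma_1)} = (\int_{\mathbb{R}} |f|^p\,d\gamma_1)^{1/p}$ for measurable $f:\mathbb{R}\to\mathbb{C}$. For an integer $k\ge0$ the Hermite polynomial is $H_k(x) = \int_{\mathbb{R}} (x+iy)^k\,d\gamma_1(y)$. For an integer $d\ge 0$, $\mathcal{P}^{\geq d}$ is the space of all finite sums $\sum_{k\ge d} c_k H_k$ with $c_k\in\mathbb{C}$. $L$ is the (positive) generator of the Ornstein--Uhlenbeck semigroup, $Lf(x) = -(f''(x) - x f'(x))$, so that $LH_k = kH_k$. *)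

(* Defs.v *)
From HB Require Import structures.
From mathcomp Require Import all_boot all_order all_algebra.
From mathcomp Require Import complex.
From mathcomp Require Import all_classical all_reals all_analysis.

Set Implicit Arguments.
Unset Strict Implicit.
Unset Printing Implicit Defensive.
Import Order.TTheory GRing.Theory Num.Theory.
Import numFieldNormedType.Exports.
Local Open Scope classical_set_scope.
Local Open Scope complex_scope.
Local Open Scope ring_scope.

Section GaussianDefs.
Context {R : realType}.

(* [normal_prob 0 1] has density (2 pi)^{-1/2} exp (- x^2 / 2). *)
Definition gamma1 : probability (measurableTypeR R) R := normal_prob 0 1.

(* Extended-real valued: +oo when |f|^p is not integrable. *)
Definition gaussLp (p : R) (f : R -> R[i]) : \bar R :=
  Lnorm gamma1 p%:E (fun x => (ComplexField.Normc.normc (f x))%:E).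

(* The library has no integral of complex-valued functions: real and imaginary
   parts are integrated separately. *)
Definition gaussInt (g : R -> R[i]) : R[i] :=
  (\int[gamma1]_y complex.Re (g y)) +i* (\int[gamma1]_y complex.Im (g y)).

Definition hermite (k : nat) (x : R) : R[i] :=
  gaussInt (fun y => (x +i* y) ^+ k).

Definition hermite_tail (d : nat) : set (R -> R[i]) :=
  [set f | exists (n : nat) (c : nat -> R[i]),
     f = fun x => \sum_(d <= k < n) c k * hermite k x].

(* Derivative of a complex-valued function of a real variable, taken on real
   and imaginary parts (R[i] carries no R-normed-module structure here). *)
Definition cderive (f : R -> R[i]) (x : R) : R[i] :=
  derive1 (fun t => complex.Re (f t)) x +i* derive1 (fun t => complex.Im (f t)) x.

Definition ornstein_uhlenbeck (f : R -> R[i]) (x : R) : R[i] :=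
  - (cderive (cderive f) x - x%:C * cderive f x).

End GaussianDefs.

(* Main.v *)
Require Import Defs.
From HB Require Import structures.
From mathcomp Require Import all_boot all_order all_algebra.
From mathcomp Require Import complex.
From mathcomp Require Import all_classical all_reals all_analysis.
From mathcomp Require Import measurable_realfun.
From mathcomp Require Import ring lra zify.

Set Implicit Arguments.
Unset Strict Implicit.
Unset Printing Implicit Defensive.
Import Order.TTheory GRing.Theory Num.Theory.
Import numFieldNormedType.Exports.
Local Open Scope classical_set_scope.
Local Open Scope ring_scope.

(** Write c = 1/(2p) and b = 1/2 - c. As e^(-x^2/2) = (e^(-c x^2))^p, the Gaussian
    L^p norm of a polynomial U is, up to a constant factor, the Lebesgue L^p norm
    of psi(x) = U(x) e^(-c x^2), the function [gpoly c U]. The Hermite polynomials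
    satisfy H_(k+1) = X H_k - H_k', so integration by parts shows that the real
    and imaginary parts of f are real polynomials orthogonal to all polynomials
    of degree less than d ([gtail d]). It is enough to treat such a U.

    A gain of a factor sqrt d comes from two sources.

    Far from the origin, it comes from Hardy inequalities. If U has mean
    zero then |(1 + |x|) psi| has L^p norm at most C times that of U' e^(-c x^2)
    ([hardy_mean]), and for any U it is at most C times that of
    (U' - X U) e^(-c x^2) ([hardy_infty]). Both follow by integrating a derivative,
    from the origin or from infinity, which produces the kernel
    (1 + |x| + |t|) e^(-s |x^2 - t^2| / 2); its marginals are bounded, so the Schur
    test applies. When |x| is at least a multiple of sqrt d, the factor |x| is the
    gain.

    Near the origin, it comes from orthogonality ([local_estimate]). Let n be
    about d / 6 and tau a small multiple of sqrt n, let S_n and E_n be Taylor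
    polynomials of (1 - cos v) / v^2 and of e^z, and let
    K(y) = tau S_n(tau (x - y))^2 E_n(b y^2), a polynomial of degree less than d.
    For |x| <= sqrt n / 4 the function K(y) e^(-b y^2) is nonnegative, is at most
    40 tau / (1 + tau^2 (x - y)^2)^2, and has mass bounded below ([kernel_upper],
    [kernel_lower]): where tau (x - y) is too large for the Taylor polynomial of
    the cosine to be bounded, E_n(b y^2) e^(-b y^2) is small. Because b + c = 1/2,
    orthogonality says that psi integrates to zero against K(y) e^(-b y^2). Hence
    psi(x) is controlled by the increments psi(x) - psi(y), and |psi(x)| is at most C
    times the integral of |psi'(t)| / (1 + tau^2 (x - t)^2), an operator of norm
    O(1 / tau) on L^p.

    The two sources together give the gradient inequality ([favard_gradient]).
    For the generator it is applied twice ([favard_generator]), since U' is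
    orthogonal to the degrees below d - 1, and U'' is recovered from
    U'' - X U' by [hardy_infty]. *)

(** * Lebesgue integrals of derivatives *)
Section Integration.
Context {R : realType}.
Local Notation mu := (@lebesgue_measure R).
Implicit Types (f g h F : R -> R).

Lemma continuous_derivable (F f : R -> R) :
  (forall x : R, is_derive x 1 F (f x)) -> continuous F.
Proof.
move=> dF x; apply: differentiable_continuous.
by apply/derivable1_diffP; have [] := dF x.
Qed.

Lemma integral_itv_derive (F f : R -> R) (a b : R) : a < b ->
  (forall x : R, is_derive x 1 F (f x)) -> continuous f ->
  (\int[mu]_(x in `[a, b]) (f x)%:E = (F b - F a)%:E)%E.
Proof.
move=> ab dF cf; rewrite EFinB.
have cF := continuous_derivable dF.
apply: (@continuous_FTC2 _ f F) => //.
- exact: continuous_subspaceT.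
- split.
  + by move=> x _; have [] := dF x.
  + exact: cvg_at_right_filter (cF a).
  + exact: cvg_at_left_filter (cF b).
- by move=> x _; rewrite derive1E; have [_] := dF x.
Qed.

Lemma integral_ball_cvg (f : R -> R) : measurable_fun setT f ->
  (forall x, 0 <= f x) ->
  (\int[mu]_(x in `[(- k%:R)%R, k%:R%R]) (f x)%:E @[k --> \oo] -->
   \int[mu]_x (f x)%:E)%E.
Proof.
move=> mf f0.
have -> : [set: R] = \bigcup_k `[(- k%:R)%R, k%:R%R]%classic.
  apply/seteqP; split => // x _; exists (Num.truncn `|x|).+1 => //=.
  by rewrite in_itv /= -ler_norml ltW // truncnS_gt.
apply: ge0_nondecreasing_set_cvg_integral => //.
- move=> m n mn; apply/subsetPset => x /=; rewrite !in_itv /= -!ler_norml.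
  by move=> /le_trans; apply; rewrite ler_nat.
- by move=> i; apply/measurable_EFinP; apply: measurable_funTS.
- by move=> i x _; rewrite lee_fin.
Qed.

(** Only a bound on the oscillation of the primitive is needed, so no limit
    at infinity has to be computed. *)
Lemma integral_derive_le (F f : R -> R) (C : R) :
  (forall x : R, is_derive x 1 F (f x)) -> continuous f ->
  (forall x, 0 <= f x) -> (forall x y, F x - F y <= C) ->
  (\int[mu]_x (f x)%:E <= C%:E)%E.
Proof.
move=> dF cf f0 FC.
have mf : measurable_fun setT f by exact: continuous_measurable_fun.
apply: (@cvge_le _ _ _ _ _ _ _ _ (integral_ball_cvg mf f0)).
near=> k.
rewrite (integral_itv_derive _ dF cf) ?lee_fin ?FC //.
rewrite -subr_gt0 opprK -natrD ltr0n addn_gt0.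
by apply/orP; left; near: k; exists 1%N.
Unshelve. all: by end_near. Qed.

End Integration.

(** * Cauchy kernels and increments *)
Section CauchyAndIncrements.
Context {R : realType}.
Local Notation mu := (@lebesgue_measure R).
Implicit Types (f g h F : R -> R).

Lemma measurable_continuous (f : R -> R) : continuous f -> measurable_fun setT f.
Proof. exact: continuous_measurable_fun. Qed.

Lemma continuous_lorentz (tau x : R) :
  continuous (fun t => (1 + (tau * (t - x)) ^+ 2)^-1).
Proof.
move=> t; apply: cvgV; first by rewrite gt_eqF // ltr_pwDl // sqr_ge0.
apply: cvgD; first exact: cvg_cst.
apply: (@continuous_comp _ _ _ (fun t => tau * (t - x)) (fun u : R => u ^+ 2)).
  apply: cvgM; first exact: cvg_cst.
  by apply: cvgB; [exact: cvg_id|exact: cvg_cst].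
exact: exprn_continuous.
Qed.

Lemma continuous_cauchy (tau x : R) :
  continuous (fun t => tau / (1 + (tau * (t - x)) ^+ 2)).
Proof.
by move=> t; apply: cvgM; [exact: cvg_cst|exact: continuous_lorentz].
Qed.

Lemma cauchy_ge0 (tau x t : R) : 0 <= tau -> 0 <= tau / (1 + (tau * (t - x)) ^+ 2).
Proof. by move=> tau0; rewrite divr_ge0 // addr_ge0 // sqr_ge0. Qed.

Lemma integral_cauchy_le (tau x : R) : 0 < tau ->
  (\int[mu]_t (tau / (1 + (tau * (t - x)) ^+ 2))%:E <= pi%:E)%E.
Proof.
move=> tau0.
apply: (@integral_derive_le _ (fun t => atan (tau * (t - x)))).
- move=> t.
  have d1 : is_derive t 1 (fun t => tau * (t - x)) tau.
    by apply: is_derive_eq; rewrite subr0 /GRing.scale/= mulr1.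
  apply: is_derive_eq (is_derive1_comp (is_derive1_atan _) d1) _.
  by rewrite mulrC.
- exact: continuous_cauchy.
- by move=> t; rewrite divr_ge0 ?ltW // ltr_pwDl // sqr_ge0.
- move=> s t.
  have := atan_ltpi2 (tau * (s - x)); have := atan_gtNpi2 (tau * (t - x)).
  by lra.
Qed.

(** The fundamental theorem of calculus in the form used throughout: the
    majorant [h] dominates the weighted derivative between the two points and is
    merely nonnegative elsewhere, so an indicator of the interval never has to
    appear under the integral sign. *)
Lemma increment_le_integral (F f h : R -> R) (x y a : R) :
  (forall t : R, is_derive t 1 F (f t)) -> continuous f ->
  measurable_fun setT h -> (forall t, 0 <= h t) -> 0 <= a ->
  (forall t, Num.min x y <= t <= Num.max x y -> a * `|f t| <= h t) ->
  ((a * `|F x - F y|)%:E <= \int[mu]_t (h t)%:E)%E.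
Proof.
move=> dF cf mh h0 a0.
have I0 : (0 <= \int[mu]_t (h t)%:E)%E by apply: integral_ge0 => t _; rewrite lee_fin.
wlog xy : x y / x < y => [W|].
  have [xy|yx|->] := ltgtP x y; last 1 first.
  - by move=> _; rewrite subrr normr0 mulr0.
  - by move=> H; apply: W => //; rewrite minElt maxElt xy.
  - by move=> H; rewrite distrC; apply: W => //; rewrite minElt maxElt yx.
rewrite minElt maxElt xy => H.
have mf := measurable_continuous cf.
have mI : measurable (`[x, y]%classic : set R) by exact: measurable_itv.
have -> : ((a * `|F x - F y|)%:E = a%:E * `|\int[mu]_(t in `[x, y]) (f t)%:E|)%E.
  by rewrite (integral_itv_derive xy dF cf) distrC.
apply: (@le_trans _ _ (a%:E * \int[mu]_(t in `[x, y]) `|f t|%:E)%E).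
  apply: lee_wpmul2l; first by rewrite lee_fin.
  apply: le_abse_integral => //. apply: measurableT_comp => //; exact: measurable_funTS.
rewrite -ge0_integralZl ?lee_fin //; last first.
  by do 2 apply: measurableT_comp => //; exact: measurable_funTS.
apply: (@le_trans _ _ (\int[mu]_(t in `[x, y]) (h t)%:E)%E).
  apply: ge0_le_integral => //.
  - by move=> t _; rewrite -EFinM lee_fin mulr_ge0.
  - apply/measurable_EFinP; apply: measurable_funM => //.
    by apply: measurableT_comp => //; exact: measurable_funTS.
  - by apply/measurable_EFinP; exact: measurable_funTS.
apply: ge0_subset_integral => //; first exact/measurable_EFinP.
by move=> t _; rewrite lee_fin.
Qed.

End CauchyAndIncrements.

(** * Polynomials times a Gaussian *)
Section GaussianPolynomials.
Context {R : realType}.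
Local Notation mu := (@lebesgue_measure R).
Implicit Types (P Q : {poly R}) (c x : R).

Definition gpoly c P x : R := P.[x] * expR (- (c * x ^+ 2)).

(** The polynomial factor of the derivative of [gpoly c P]. For c = 1/2 it is
    P' - X P, so that [gderiv 2^-1 U^`()] is, up to sign, the
    Ornstein-Uhlenbeck generator applied to U. *)
Definition gderiv c P : {poly R} := P^`() - (2 * c) *: ('X * P).

Lemma is_derive_gpoly c P x : is_derive x 1 (gpoly c P) (gpoly c (gderiv c P) x).
Proof.
have d1 : is_derive x 1 (fun t : R => - (c * t ^+ 2)) (- (2 * c * x)).
  by apply: is_derive_eq; rewrite /GRing.scale /= ?mulr1; ring.
have d2 : is_derive x 1 (fun t => expR (- (c * t ^+ 2)))
    (expR (- (c * x ^+ 2)) * - (2 * c * x)).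
  exact: (@is_derive1_comp _ expR (fun t => - (c * t ^+ 2)) _ _ _ (is_derive_expR _) d1).
apply: is_derive_eq (is_deriveM (is_derive_poly P x) d2) _.
by rewrite /gpoly /gderiv !hornerE /GRing.scale /=; ring.
Qed.

Lemma continuous_gpoly c P : continuous (gpoly c P).
Proof. exact: continuous_derivable (is_derive_gpoly c P). Qed.

Lemma measurable_gpoly c P : measurable_fun setT (gpoly c P).
Proof. apply: measurable_continuous; exact: continuous_gpoly. Qed.

Lemma gpolyM c1 c2 P Q x : gpoly c1 P x * gpoly c2 Q x = gpoly (c1 + c2) (P * Q) x.
Proof. by rewrite /gpoly hornerM mulrDl opprD expRD; ring. Qed.

Lemma gpolyD c P Q x : gpoly c (P + Q) x = gpoly c P x + gpoly c Q x.
Proof. by rewrite /gpoly hornerD mulrDl. Qed.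

Lemma gpolyZ c a P x : gpoly c (a *: P) x = a * gpoly c P x.
Proof. by rewrite /gpoly hornerZ mulrA. Qed.

Lemma gpolyB c P Q x : gpoly c (P - Q) x = gpoly c P x - gpoly c Q x.
Proof. by rewrite /gpoly hornerD hornerN mulrDl mulNr. Qed.

Lemma gpoly0 c x : gpoly c 0 x = 0.
Proof. by rewrite /gpoly horner0 mul0r. Qed.

Lemma gpolyXM c P x : gpoly c ('X * P) x = x * gpoly c P x.
Proof. by rewrite /gpoly hornerM hornerX; ring. Qed.

(** By induction on the degree: half of the Gaussian absorbs the additional
    factor x, the other half is left to the induction hypothesis. *)
Lemma gpoly_bounded c P : 0 < c -> exists2 C : R, 0 <= C & forall x, `|gpoly c P x| <= C.
Proof.
elim/poly_ind: P c => [|P a IH] c c0.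
  by exists 0 => // x; rewrite gpoly0 normr0.
have c20 : 0 < c / 2 by rewrite divr_gt0.
have [C C0 HC] := IH _ c20.
exists (C * (1 + 2 / c) + `|a|); first by rewrite addr_ge0 // mulr_ge0 // addr_ge0 // divr_ge0 // ltW.
move=> x.
have E1 : expR (- (c * x ^+ 2)) <= 1 by rewrite expR_le1 oppr_le0 mulr_ge0 ?sqr_ge0 // ltW.
have -> : gpoly c (P * 'X + a%:P) x =
    gpoly (c / 2) P x * (x * expR (- (c / 2 * x ^+ 2))) + a * expR (- (c * x ^+ 2)).
  rewrite /gpoly !(hornerD, hornerM, hornerX, hornerC).
  have -> : - (c * x ^+ 2) = - (c / 2 * x ^+ 2) - (c / 2 * x ^+ 2) by field.
  by rewrite expRD; ring.
apply: (le_trans (ler_normD _ _)); apply: lerD; last first.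
  by rewrite normrM [`|expR _|]ger0_norm ?expR_ge0 // ler_piMr.
rewrite normrM; apply: ler_pM => //.
rewrite normrM [`|expR _|]ger0_norm ?expR_ge0 //.
rewrite expRN -ler_pdivlMr ?invr_gt0 ?expR_gt0 // invrK.
apply: (@le_trans _ _ ((1 + 2 / c) * (1 + c / 2 * x ^+ 2))); last first.
  by rewrite ler_pM2l ?expR_ge1Dx // addr_gt0 // divr_gt0.
have -> : (1 + 2 / c) * (1 + c / 2 * x ^+ 2) = 1 + 2 / c + c / 2 * x ^+ 2 + x ^+ 2.
  by field; rewrite gt_eqF.
have h1 : 0 <= 2 / c by rewrite divr_ge0 // ltW.
have h2 : 0 <= c / 2 * x ^+ 2 by rewrite mulr_ge0 ?sqr_ge0 // divr_ge0 // ltW.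
have h3 : `|x| <= 1 + x ^+ 2.
  by rewrite -real_normK ?num_real //; nra.
lra.
Qed.

Lemma gpoly_decay c P : 0 < c ->
  exists2 C : R, 0 <= C & forall x, `|gpoly c P x| <= C * (1 + x ^+ 2)^-1.
Proof.
move=> c0; have [C C0 HC] := gpoly_bounded (P * (1 + 'X^2)) c0.
exists C => // x.
have D0 : 0 < 1 + x ^+ 2 by rewrite ltr_pwDl // sqr_ge0.
rewrite ler_pdivlMr //; apply: le_trans (HC x).
rewrite /gpoly hornerM !hornerE !normrM (ger0_norm (ltW D0)).
by rewrite mulrAC.
Qed.

Lemma integral_decay_le (h : R -> R) (D : R) : 0 <= D -> measurable_fun setT h ->
  (forall t, 0 <= h t) -> (forall t, h t <= D * (1 + t ^+ 2)^-1) ->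
  (\int[mu]_t (h t)%:E <= (D * pi)%:E)%E.
Proof.
move=> D0 mh h0 hD.
have mc : measurable_fun setT (fun t : R => 1 / (1 + (1 * (t - 0)) ^+ 2)).
  by apply: measurable_continuous; exact: continuous_cauchy.
apply: (@le_trans _ _ (\int[mu]_t (D%:E * (1 / (1 + (1 * (t - 0)) ^+ 2))%:E))%E).
  apply: ge0_le_integral => //.
  - by move=> t _; rewrite lee_fin.
  - exact/measurable_EFinP.
  - by apply/measurable_EFinP; apply: measurable_funM.
  - move=> t _ /=; rewrite lee_fin; apply: le_trans (hD t) _.
    by rewrite subr0 !mul1r.
rewrite ge0_integralZl ?lee_fin //.
- by rewrite EFinM lee_wpmul2l ?lee_fin //; exact: integral_cauchy_le.
- by apply/measurable_EFinP; exact: mc.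
- by move=> t _; rewrite lee_fin cauchy_ge0.
Qed.

Lemma integrable_of_decay (f : R -> R) (C : R) : measurable_fun setT f ->
  (forall x, `|f x| <= C * (1 + x ^+ 2)^-1) -> mu.-integrable setT (EFin \o f).
Proof.
move=> mf fC; apply/integrableP; split; first exact/measurable_EFinP.
have C0 : 0 <= C.
  by have := le_trans (normr_ge0 _) (fC 0); rewrite expr0n /= addr0 invr1 mulr1.
apply: (@le_lt_trans _ _ (C * pi)%:E); last exact: ltry.
by apply: integral_decay_le => //; exact: measurableT_comp.
Qed.

Lemma integrable_gpoly c P : 0 < c -> mu.-integrable setT (EFin \o gpoly c P).
Proof.
move=> c0; have [C _ HC] := gpoly_decay P c0.
exact: integrable_of_decay (measurable_gpoly c P) HC.
Qed.

Lemma gpoly_small c P (e : R) : 0 < c -> 0 < e ->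
  exists2 M : R, 0 < M & forall x, M <= `|x| -> `|gpoly c P x| <= e.
Proof.
move=> c0 e0; have [C C0 HC] := gpoly_decay P c0.
exists (1 + C / e); first by rewrite ltr_pwDl // divr_ge0 // ltW.
move=> x Mx; apply: le_trans (HC x) _.
have D0 : 0 < 1 + x ^+ 2 by rewrite ltr_pwDl // sqr_ge0.
have Ce : 0 <= C / e by rewrite divr_ge0 // ltW.
rewrite ler_pdivrMr // mulrC -ler_pdivrMr //.
rewrite -(real_normK (num_real x)); nra.
Qed.

End GaussianPolynomials.

(** * Gaussian integration by parts and orthogonality *)
Section GaussianIntegral.
Context {R : realType}.
Local Notation mu := (@lebesgue_measure R).
Implicit Types (P Q U : {poly R}) (c x : R).

Lemma integral_ball_cvg_integrable (f : R -> R) : mu.-integrable setT (EFin \o f) ->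
  (\int[mu]_(x in `[(- k%:R)%R, k%:R%R]) (f x)%:E @[k --> \oo] -->
   \int[mu]_x (f x)%:E)%E.
Proof.
move=> fi.
under eq_fun do rewrite integral_mkcond.
apply: (@dominated_cvg _ _ _ mu setT measurableT _ (EFin \o f)
         (fun x => `|(f x)%:E|)%E) => //.
- move=> k; apply/measurable_restrict => //=; rewrite setTI.
  exact: measurable_funTS (measurable_int mu fi).
- move=> x _; apply: cvg_near_cst; near=> k.
  rewrite patchE ifT // inE /= in_itv /= -ler_norml.
  by near: k; exact: nbhs_infty_ger.
- exact: integrable_abse.
- by move=> k x _; rewrite patchE; case: ifPn => // _; rewrite abse0.
Unshelve. all: by end_near. Qed.

Lemma integral_gderiv c P : 0 < c -> (\int[mu]_x (gpoly c (gderiv c P) x)%:E = 0)%E.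
Proof.
move=> c0; set h := gpoly c (gderiv c P).
have hi : mu.-integrable setT (EFin \o h) by exact: integrable_gpoly.
have hfin := integrable_fin_num measurableT hi.
suff H : forall e : R, 0 < e -> (`|\int[mu]_x (h x)%:E| <= e%:E)%E.
  rewrite -(fineK hfin); congr EFin; apply/eqP; rewrite -normr_le0.
  apply/ler_addgt0Pl => e e0; rewrite addr0.
  by have := H e e0; rewrite -[X in `|X|%E](fineK hfin) abse_EFin lee_fin.
move=> e e0.
have [M M0 HM] := gpoly_small P c0 (divr_gt0 e0 (@ltr0Sn R 1)).
apply: (@cvge_le _ _ _ _ _ _ _ _ (cvg_abse (integral_ball_cvg_integrable hi))).
near=> k.
have kM : M <= k%:R by near: k; exact: nbhs_infty_ger.
have k0 : 0 < k%:R :> R by exact: lt_le_trans M0 kM.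
rewrite (integral_itv_derive _ (is_derive_gpoly c P)); last 2 first.
- by rewrite gtrN.
- exact: continuous_gpoly.
rewrite abse_EFin lee_fin (le_trans (ler_normB _ _)) //.
rewrite [e]splitr lerD // HM // ?normrN ger0_norm // ltW //.
Unshelve. all: by end_near. Qed.

(** The normalisation of the Gaussian density is omitted; [gint 1] is the
    square root of 2 pi. *)
Definition gint P : R := \int[mu]_x gpoly 2^-1 P x.

Let half_gt0 : 0 < 2^-1 :> R. Proof. by rewrite invr_gt0. Qed.

Lemma gintD P Q : gint (P + Q) = gint P + gint Q.
Proof.
rewrite /gint -RintegralD //; try exact: integrable_gpoly.
by apply: eq_Rintegral => x _; rewrite gpolyD.
Qed.

Lemma gintZ a P : gint (a *: P) = a * gint P.
Proof.
rewrite /gint -RintegralZl //; try exact: integrable_gpoly.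
by apply: eq_Rintegral => x _; rewrite gpolyZ.
Qed.

Lemma gintN P : gint (- P) = - gint P.
Proof. by rewrite -scaleN1r gintZ mulN1r. Qed.

Lemma gintB P Q : gint (P - Q) = gint P - gint Q.
Proof. by rewrite gintD gintN. Qed.

Lemma gint0 : gint 0 = 0.
Proof. by rewrite -(scale0r 0) gintZ mul0r. Qed.

Lemma gint_sum (I : Type) (r : seq I) (p : pred I) (F : I -> {poly R}) :
  gint (\sum_(i <- r | p i) F i) = \sum_(i <- r | p i) gint (F i).
Proof. by elim/big_rec2: _ => [|i y x _ <-]; rewrite ?gint0 ?gintD. Qed.

Lemma gint_by_parts P : gint ('X * P) = gint P^`().
Proof.
apply/eqP; rewrite eq_sym -subr_eq0 -gintB.
have -> : P^`() - 'X * P = gderiv 2^-1 P by rewrite /gderiv mulfV ?scale1r.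
by rewrite /gint /Rintegral integral_gderiv.
Qed.

Lemma gint1_gt0 : 0 < gint 1.
Proof.
rewrite /gint; have E : forall x : R, gpoly 2^-1 1 x = normal_fun 0 1 x.
  move=> x; rewrite /gpoly /normal_fun hornerC mul1r subr0 expr1n; congr expR.
  by rewrite mulNr mulrC.
have p0 : 0 < normal_peak 1 :> R by rewrite normal_peak_gt0.
have := @integral_normal_pdf R 0 1; rewrite normal_pdfE //.
under eq_integral => x _ do rewrite -E EFinM.
rewrite integralZl //; last exact: integrable_gpoly.
rewrite -(fineK (integrable_fin_num measurableT (integrable_gpoly 1 half_gt0))) -EFinM.
move=> [] H; rewrite -(pmulr_rgt0 _ p0) /Rintegral.
by rewrite [X in 0 < X]H.
Qed.

Definition gtail d U := forall Q, (size Q <= d)%N -> gint (U * Q) = 0.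

(** The derivative is adjoint to Q -> X Q - Q', which raises the degree by at
    most one. *)
Lemma gtail_deriv d U : gtail d.+1 U -> gtail d U^`().
Proof.
move=> HU Q sQ.
have := gint_by_parts (U * Q).
have -> : 'X * (U * Q) = U * ('X * Q) by rewrite mulrCA.
have sXQ : (size ('X * Q)%R <= d.+1)%N.
  by rewrite mulrC; apply: leq_trans (size_polyMleq _ _) _; rewrite size_polyX addn2.
have sQ' : (size Q^`() <= d.+1)%N.
  apply: leq_trans (leqW sQ).
  by apply: leq_trans (size_poly _ _) _; rewrite leq_pred.
by rewrite derivM gintD (HU _ sXQ) (HU _ sQ') addr0.
Qed.

Lemma gint_tail d U : gtail d.+1 U -> gint U = 0.
Proof. by move=> /(_ 1); rewrite mulr1 size_poly1; apply. Qed.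

End GaussianIntegral.

(** * The Schur test *)
Section LebesgueNorm.
Context {R : realType}.
Local Notation mu := (@lebesgue_measure R).
Implicit Types (f g : R -> R) (p : R).

Definition Lp p f : \bar R := Lnorm mu p%:E (EFin \o f).

Lemma LpE p f : Lp p f = ((\int[mu]_x (`|f x| `^ p)%:E) `^ p^-1)%E.
Proof. by rewrite /Lp unlock. Qed.

Lemma Lp_ge0 p f : (0 <= Lp p f)%E. Proof. exact: Lnorm_ge0. Qed.

Lemma measurable_norm_powR p f : measurable_fun setT f ->
  measurable_fun setT (fun x => `|f x| `^ p).
Proof.
move=> mf; apply: (@measurableT_comp _ _ _ _ _ _ (@powR R ^~ p)) => //.
exact: measurableT_comp.
Qed.

Lemma Lp_le_of_integral p f g (c : R) : 0 < p -> 0 <= c ->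
  (\int[mu]_x (`|f x| `^ p)%:E <= (c `^ p)%:E * \int[mu]_x (`|g x| `^ p)%:E)%E ->
  (Lp p f <= c%:E * Lp p g)%E.
Proof.
move=> p0 c0 H; rewrite !LpE.
have I0 (h : R -> R) : (0 <= \int[mu]_x (`|h x| `^ p)%:E)%E.
  by apply: integral_ge0 => x _; rewrite lee_fin powR_ge0.
have -> : (c%:E = (c `^ p)%:E `^ p^-1)%E.
  by rewrite poweR_EFin -powRrM mulfV ?powRr1 // gt_eqF.
rewrite -poweRM ?lee_fin ?powR_ge0 //.
apply: gt0_ler_poweR => //; first by rewrite invr_ge0 ltW.
- by rewrite in_itv /= leey I0.
- by rewrite in_itv /= leey mule_ge0 ?I0 // lee_fin powR_ge0.
Qed.

Lemma Lp_le p f g (c : R) : 0 < p -> 0 <= c ->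
  measurable_fun setT f -> measurable_fun setT g ->
  (forall x, `|f x| <= c * `|g x|) -> (Lp p f <= c%:E * Lp p g)%E.
Proof.
move=> p0 c0 mf mg fg; apply: Lp_le_of_integral => //.
have mgp := measurable_norm_powR p mg.
rewrite -ge0_integralZl ?lee_fin ?powR_ge0 //; last exact/measurable_EFinP.
apply: ge0_le_integral => //.
- by apply/measurable_EFinP; exact: measurable_norm_powR.
- by apply/measurable_EFinP; exact: measurable_funM.
- move=> x _; rewrite -EFinM lee_fin -powRM //.
  by apply: ge0_ler_powR => //; rewrite ?nnegrE ?mulr_ge0 // ltW.
Qed.

Lemma Lp_triangle p f g (h : R -> R) (c1 c2 : R) : 1 <= p -> 0 <= c1 -> 0 <= c2 ->
  measurable_fun setT f -> measurable_fun setT g -> measurable_fun setT h ->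
  (forall x, `|f x| <= c1 * `|g x| + c2 * `|h x|) ->
  (Lp p f <= c1%:E * Lp p g + c2%:E * Lp p h)%E.
Proof.
move=> p1 c10 c20 mf mg mh fgh.
have p0 : 0 < p by exact: lt_le_trans p1.
pose g' x := c1 * `|g x|; pose h' x := c2 * `|h x|.
have mg' : measurable_fun setT g' by apply: measurable_funM => //; exact: measurableT_comp.
have mh' : measurable_fun setT h' by apply: measurable_funM => //; exact: measurableT_comp.
apply: (@le_trans _ _ (Lp p (g' \+ h'))).
  rewrite -[leRHS]mul1e; apply: Lp_le => //; first exact: measurable_funD.
  move=> x; rewrite mul1r [leRHS]ger0_norm; first exact: fgh.
  by rewrite /= addr_ge0 ?mulr_ge0.
apply: le_trans (minkowski_EFin mu mg' mh' p1) _.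
by apply: leeD; apply: Lp_le => // x; rewrite /g' /h' normrM normr_id (ger0_norm c10, ger0_norm c20).
Qed.

(** Hoelder's inequality applied to the factorisation
    k |g| = k^(1/q) (k^(1/p) |g|) bounds |f x|^p by A^(p-1) times the integral
    of k(x, .) |g|^p; Tonelli's theorem and the bound on the other marginal then
    give A^p times the integral of |g|^p. *)
Lemma schur_test p (A : R) (k : R -> R -> R) f g : 1 < p -> 0 <= A ->
  (forall x t, 0 <= k x t) ->
  measurable_fun setT (fun z : R * R => k z.1 z.2) ->
  (forall x, (\int[mu]_t (k x t)%:E <= A%:E)%E) ->
  (forall t, (\int[mu]_x (k x t)%:E <= A%:E)%E) ->
  measurable_fun setT f -> measurable_fun setT g ->
  (forall x, (`|f x|%:E <= \int[mu]_t (k x t * `|g t|)%:E)%E) ->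
  (Lp p f <= A%:E * Lp p g)%E.
Proof.
move=> p1 A0 k0 mk kt kx mf mg fkg.
have p0 : 0 < p by exact: lt_trans p1.
pose q := p / (p - 1).
have q0 : 0 < q by rewrite divr_gt0 // subr_gt0.
have pq : q^-1 + p^-1 = 1 by rewrite /q; field; rewrite !gt_eqF // subr_gt0.
have mkx x : measurable_fun setT (k x).
  exact: (measurableT_comp mk (pair1_measurable x)).
have mgp := measurable_norm_powR p mg.
pose J x := (\int[mu]_t (k x t * `|g t| `^ p)%:E)%E.
have J0 x : (0 <= J x)%E.
  by apply: integral_ge0 => t _; rewrite lee_fin mulr_ge0 ?powR_ge0.
have point x : ((`|f x| `^ p)%:E <= ((A `^ q^-1) `^ p)%:E * J x)%E.
  pose u t := k x t `^ q^-1; pose v t := k x t `^ p^-1 * `|g t|.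
  have mu_ : measurable_fun setT u.
    exact: (@measurableT_comp _ _ _ _ _ _ (@powR R ^~ q^-1)).
  have mv : measurable_fun setT v.
    apply: measurable_funM; first exact: (@measurableT_comp _ _ _ _ _ _ (@powR R ^~ p^-1)).
    exact: measurableT_comp.
  have := hoelder mu mu_ mv q0 p0 pq.
  rewrite Lnorm1 -/(Lp q u) -/(Lp p v) !LpE.
  under eq_integral => t _.
    have -> : (`|(EFin \o (u \* v)%R) t| = (k x t * `|g t|)%:E)%E.
      rewrite /= ger0_norm /u /v; last by rewrite !mulr_ge0 ?powR_ge0.
      rewrite mulrA -powRD ?pq ?powRr1 //.
      by rewrite oner_eq0 implyFb.
    over.
  under [X in (_ <= X `^ _ * _)%E]eq_integral => t _.
    rewrite ger0_norm ?powR_ge0 // /u -powRrM mulVf ?gt_eqF // powRr1 //.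
    over.
  under [X in (_ <= _ * X `^ _)%E]eq_integral => t _.
    rewrite normrM normr_id ger0_norm ?powR_ge0 // powRM ?powR_ge0 //.
    rewrite -powRrM mulVf ?gt_eqF // powRr1 //.
    over.
  rewrite -/(J x) => /(le_trans (fkg x)) H.
  have {}H : (`|f x|%:E <= (A `^ q^-1)%:E * J x `^ p^-1)%E.
    apply: le_trans H _; apply: lee_wpmul2r; first exact: poweR_ge0.
    rewrite -poweR_EFin; apply: gt0_ler_poweR => //; first by rewrite invr_ge0 ltW.
    - by rewrite in_itv /= leey integral_ge0 // => t _; rewrite lee_fin.
    - by rewrite in_itv /= leey lee_fin A0.
  rewrite -[(`|f x| `^ p)%:E]poweR_EFin -[((A `^ q^-1) `^ p)%:E]poweR_EFin.
  have -> : (J x = (J x `^ p^-1) `^ p)%E.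
    by rewrite -poweRrM mulVf ?gt_eqF // poweRe1.
  rewrite -poweRM ?lee_fin ?powR_ge0 ?poweR_ge0 //.
  apply: gt0_ler_poweR => //; first exact: ltW.
  - by rewrite in_itv /= leey lee_fin normr_ge0.
  - by rewrite in_itv /= leey mule_ge0 ?poweR_ge0 // lee_fin powR_ge0.
pose F (z : R * R) := (k z.1 z.2 * `|g z.2| `^ p)%:E.
have mF : measurable_fun setT F.
  apply/measurable_EFinP; apply: measurable_funM => //.
  exact: (measurableT_comp mgp (@measurable_snd _ _ _ _)).
have F0 z : (0 <= F z)%E by rewrite lee_fin mulr_ge0 ?powR_ge0.
have mJ : measurable_fun setT J.
  exact: (@measurable_fun_fubini_tonelli_F _ _ _ _ _ mu F mF F0).
apply: Lp_le_of_integral => //.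
apply: (@le_trans _ _ (\int[mu]_x (((A `^ q^-1) `^ p)%:E * J x))%E).
  apply: ge0_le_integral => //.
  - by apply/measurable_EFinP; exact: measurable_norm_powR.
  - exact: measurable_funeM.
rewrite ge0_integralZl ?lee_fin ?powR_ge0 //.
have -> : (\int[mu]_x J x = \int[mu]_t \int[mu]_x (k x t * `|g t| `^ p)%:E)%E.
  exact: (@fubini_tonelli _ _ _ _ _ mu mu F mF F0).
have AE : A `^ p = (A `^ q^-1) `^ p * A.
  have [->|A1] := eqVneq A 0; first by rewrite mulr0 powR0 // gt_eqF.
  rewrite -{3}(@powRr1 _ A) // -powRrM -powRD ?A1 ?implybT //; congr powR.
  by rewrite /q; field; rewrite !gt_eqF // subr_gt0.
rewrite AE EFinM -muleA; apply: lee_wpmul2l; first by rewrite lee_fin powR_ge0.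
rewrite -ge0_integralZl ?lee_fin //; last exact/measurable_EFinP.
have mkt t : measurable_fun setT (k ^~ t).
  exact: (measurableT_comp mk (pair2_measurable t)).
apply: ge0_le_integral; first exact: measurableT.
- by move=> t _; apply: integral_ge0 => x _; rewrite lee_fin mulr_ge0 ?powR_ge0.
- exact: (@measurable_fun_fubini_tonelli_G _ _ _ _ _ mu F mF F0).
- apply: emeasurable_funM => //; exact/measurable_EFinP.
- move=> t _; under eq_integral do rewrite EFinM.
  rewrite ge0_integralZr ?lee_fin ?powR_ge0 //.
  + by apply: lee_wpmul2r => //; rewrite lee_fin powR_ge0.
  + by apply/measurable_EFinP; exact: mkt.
  + by move=> x _; rewrite lee_fin.
Qed.

End LebesgueNorm.

(** * The kernel of the Hardy inequalities *)
Section HardyKernel.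
Context {R : realType}.
Local Notation mu := (@lebesgue_measure R).
Implicit Types (s c x t : R) (U V P : {poly R}).

(** When x and t have the same sign, |x - t| (|x| + |t|) = |x^2 - t^2|, and this
    is how the kernel arises. The formula below is also defined, and has bounded
    marginals, without that restriction. *)
Definition hardyk s x t : R :=
  (1 + `|x| + `|t|) * expR (- (s / 2 * (`|x - t| * (`|x| + `|t|)))).

Lemma hardykC s x t : hardyk s x t = hardyk s t x.
Proof. by rewrite /hardyk distrC addrAC [`|x| + _]addrC. Qed.

Lemma hardyk_ge0 s x t : 0 <= hardyk s x t.
Proof. by rewrite mulr_ge0 ?expR_ge0 // !addr_ge0. Qed.

Lemma measurable_hardyk s : measurable_fun setT (fun z : R * R => hardyk s z.1 z.2).
Proof.
have m1 : measurable_fun setT (fun z : R * R => `|z.1|) by apply: measurableT_comp.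
have m2 : measurable_fun setT (fun z : R * R => `|z.2|) by apply: measurableT_comp.
have m3 : measurable_fun setT (fun z : R * R => `|z.1 - z.2|).
  by apply: measurableT_comp => //; apply: measurable_funB.
apply: measurable_funM; first by do 2 (apply: measurable_funD => //).
apply: measurableT_comp => //; apply: measurableT_comp => //.
by apply: measurable_funM => //; apply: measurable_funM => //; apply: measurable_funD.
Qed.

Lemma integral_cauchy_le0 (tau x : R) : 0 <= tau ->
  (\int[mu]_t (tau / (1 + (tau * (t - x)) ^+ 2))%:E <= pi%:E)%E.
Proof.
rewrite le_eqVlt => /predU1P[<-|]; last exact: integral_cauchy_le.
under eq_integral do rewrite mul0r.
by rewrite integral0 lee_fin pi_ge0.
Qed.

(** With r = |x - t|, the exponent is at least a r^2 + a r |x| and |t| is at most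
    |x| + r. The first Gaussian absorbs 1 + r, and the exponential in r |x| is
    compared with a Cauchy kernel of width 1 / |x|, whose integral absorbs the
    factor |x|. *)
Lemma hardyk_le s : 0 < s -> exists2 C : R, 0 <= C & forall x t,
  hardyk s x t <= C * (1 / (1 + (1 * (t - x)) ^+ 2)) +
                  C * (`|x| / (1 + (`|x| * (t - x)) ^+ 2)).
Proof.
move=> s0; set a := s / 4; have a0 : 0 < a by rewrite divr_gt0.
have [C1 C10 H1] := gpoly_decay (2%:P + 'X^2) a0.
pose C2 := 2 * (1 + 2 / a ^+ 2).
have C20 : 0 <= C2 by rewrite mulr_ge0 // addr_ge0 // divr_ge0 // sqr_ge0.
exists (C1 + C2); first exact: addr_ge0.
move=> x t; set r := `|t - x|.
have r0 : 0 <= r by exact: normr_ge0.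
have rE : (t - x) ^+ 2 = r ^+ 2 by rewrite real_normK ?num_real.
have tr : `|t| <= `|x| + r by rewrite -{1}(subrK x t) addrC ler_normD.
have rt : r <= `|x| + `|t| by rewrite addrC ler_normB.
have x0 := normr_ge0 x; have t0 := normr_ge0 t.
have E : expR (- (s / 2 * (`|x - t| * (`|x| + `|t|)))) <=
         expR (- (a * r ^+ 2)) * expR (- (a * (r * `|x|))).
  rewrite -expRD ler_expR distrC -/r /a.
  have h1 : r ^+ 2 <= r * (`|x| + `|t|) by rewrite expr2 ler_wpM2l.
  have h2 : r * `|x| <= r * (`|x| + `|t|) by rewrite ler_wpM2l // lerDl.
  nra.
have e1 : expR (- (a * r ^+ 2)) <= 1.
  by rewrite expR_le1 oppr_le0 mulr_ge0 ?sqr_ge0 // ltW.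
have e2 : expR (- (a * (r * `|x|))) <= 1.
  by rewrite expR_le1 oppr_le0 !mulr_ge0 // ltW.
have e10 := expR_ge0 (- (a * r ^+ 2)); have e20 := expR_ge0 (- (a * (r * `|x|))).
have F1 : (1 + r) * expR (- (a * r ^+ 2)) <= C1 * (1 + r ^+ 2)^-1.
  apply: le_trans (H1 r); rewrite /gpoly !(hornerD, hornerC, hornerXn).
  rewrite normrM [`|expR _|]ger0_norm // ler_wpM2r //.
  by apply: le_trans (ler_norm _); nra.
have F2 : expR (- (a * (r * `|x|))) <= (1 + 2 / a ^+ 2) / (1 + (r * `|x|) ^+ 2).
  set w := r * `|x|; have w0 : 0 <= w by exact: mulr_ge0.
  have D0 : 0 < 1 + w ^+ 2 by rewrite ltr_pwDl // sqr_ge0.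
  rewrite ler_pdivlMr // expRN ler_pdivrMl ?expR_gt0 //.
  have := @expR_ge1Dxn _ (a * w) 1 (mulr_ge0 (ltW a0) w0).
  have A : 0 < 2 / a ^+ 2 by rewrite divr_gt0 // exprn_gt0.
  set e := expR _; rewrite (_ : 2`! = 2)%N // => He.
  have K : w ^+ 2 = 2 / a ^+ 2 * ((a * w) ^+ 2 / 2) by field; rewrite gt_eqF.
  have w2 : 0 <= (a * w) ^+ 2 / 2 by rewrite divr_ge0 // sqr_ge0.
  rewrite K; nra.
have -> : (1 * (t - x)) ^+ 2 = r ^+ 2 by rewrite mul1r rE.
have -> : (`|x| * (t - x)) ^+ 2 = (r * `|x|) ^+ 2 by rewrite !exprMn rE mulrC.
have G : hardyk s x t <= (1 + r) * expR (- (a * r ^+ 2)) + 2 * `|x| * expR (- (a * (r * `|x|))).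
  rewrite /hardyk; apply: (@le_trans _ _ ((1 + r + 2 * `|x|) *
     (expR (- (a * r ^+ 2)) * expR (- (a * (r * `|x|)))))).
    by apply: ler_pM; [rewrite !addr_ge0|exact: expR_ge0|lra|exact: E].
  rewrite mulrDl lerD //.
    by rewrite mulrA ler_piMr // mulr_ge0 // addr_ge0.
  by rewrite mulrA mulrAC ler_piMr // !mulr_ge0.
apply: le_trans G _.
have D1 : 0 < (1 + r ^+ 2)^-1 by rewrite invr_gt0 ltr_pwDl // sqr_ge0.
have D2 : 0 < (1 + (r * `|x|) ^+ 2)^-1 by rewrite invr_gt0 ltr_pwDl // sqr_ge0.
apply: lerD.
  by apply: le_trans F1 _; rewrite div1r ler_wpM2r ?lerDl // ltW.
apply: (@le_trans _ _ (C2 * (`|x| / (1 + (r * `|x|) ^+ 2)))); last first.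
  by rewrite ler_wpM2r ?lerDr // divr_ge0 // addr_ge0 // sqr_ge0.
have := ler_wpM2l (mulr_ge0 (ler0n R 2) x0) F2; rewrite /C2.
by move=> /le_trans; apply; rewrite le_eqVlt; apply/orP; left; apply/eqP; ring.
Qed.

Lemma integral_hardyk_le s : 0 < s -> exists2 A : R, 0 <= A &
  forall x, (\int[mu]_t (hardyk s x t)%:E <= A%:E)%E.
Proof.
move=> s0; have [C C0 HC] := hardyk_le s0.
exists (C * pi + C * pi); first by rewrite addr_ge0 // mulr_ge0 // pi_ge0.
move=> x.
have mc (tau : R) : measurable_fun setT (fun t : R => tau / (1 + (tau * (t - x)) ^+ 2)).
  by apply: measurable_continuous; exact: continuous_cauchy.
have mCc (tau : R) : measurable_fun setT (fun t : R => C * (tau / (1 + (tau * (t - x)) ^+ 2))).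
  by apply: measurable_funM.
have I (tau : R) : 0 <= tau ->
    (\int[mu]_t (C * (tau / (1 + (tau * (t - x)) ^+ 2)))%:E <= (C * pi)%:E)%E.
  move=> tau0; under eq_integral do rewrite EFinM.
  rewrite ge0_integralZl ?lee_fin //.
  - by rewrite EFinM lee_wpmul2l ?lee_fin //; exact: integral_cauchy_le0.
  - by apply/measurable_EFinP; exact: mc.
  - by move=> t _; rewrite lee_fin cauchy_ge0.
apply: (@le_trans _ _ (\int[mu]_t (C * (1 / (1 + (1 * (t - x)) ^+ 2)))%:E +
                       \int[mu]_t (C * (`|x| / (1 + (`|x| * (t - x)) ^+ 2)))%:E)%E).
  rewrite -ge0_integralD //; last 4 first.
  - by move=> t _; rewrite lee_fin mulr_ge0 // cauchy_ge0.
  - by apply/measurable_EFinP; exact: mCc.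
  - by move=> t _; rewrite lee_fin mulr_ge0 // cauchy_ge0.
  - by apply/measurable_EFinP; exact: mCc.
  apply: ge0_le_integral => //.
  - by move=> t _; rewrite lee_fin hardyk_ge0.
  - apply/measurable_EFinP.
    exact: (measurableT_comp (measurable_hardyk s) (pair1_measurable x)).
  - by apply: emeasurable_funD; apply/measurable_EFinP; exact: mCc.
  - by move=> t _; rewrite -EFinD lee_fin.
by rewrite EFinD leeD // I.
Qed.

End HardyKernel.

(** * Hardy inequalities for the Gaussian weight *)
Section HardyInequalities.
Context {R : realType}.
Local Notation mu := (@lebesgue_measure R).
Implicit Types (s c x t : R) (U V P : {poly R}).

Definition wpoly c P x : R := (1 + `|x|) * gpoly c P x.

Lemma measurable_wpoly c P : measurable_fun setT (wpoly c P).
Proof.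
apply: measurable_funM; last exact: measurable_gpoly.
by apply: measurable_funD => //; apply: measurableT_comp.
Qed.

Lemma normr_sqrB x t : 0 <= x * t -> `|t| <= `|x| ->
  `|x - t| * (`|x| + `|t|) = x ^+ 2 - t ^+ 2.
Proof.
have [x0|x0] := leP 0 x; have [t0|t0] := leP 0 t.
- rewrite (ger0_norm x0) (ger0_norm t0) => _ tx; rewrite ger0_norm ?subr_ge0 //; ring.
- rewrite (ger0_norm x0) (ltr0_norm t0) => xt tx.
  have x00 : x = 0 by nra.
  by move: tx; rewrite x00; lra.
- rewrite (ger0_norm t0) (ltr0_norm x0) => xt tx.
  have t00 : t = 0 by nra.
  rewrite t00 subr0 ltr0_norm //; ring.
- rewrite (ltr0_norm x0) (ltr0_norm t0) => _ tx; rewrite ler0_norm ?subr_le0; last lra.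
  ring.
Qed.

Lemma gpoly_norm c P x : `|gpoly c P x| = `|P.[x]| * expR (- (c * x ^+ 2)).
Proof. by rewrite /gpoly normrM (ger0_norm (expR_ge0 _)). Qed.

Lemma measurable_hardyk_gpoly s c P x :
  measurable_fun setT (fun t => hardyk s x t * `|gpoly c P t|).
Proof.
apply: measurable_funM.
  exact: (measurableT_comp (measurable_hardyk s) (pair1_measurable x)).
by apply: measurableT_comp => //; exact: measurable_gpoly.
Qed.

(** V - V(0) is the integral of V' from 0 to x; on that segment
    e^(- c x^2) = e^(- c (x^2 - t^2)) e^(- c t^2). *)
Lemma hardy_zero_pointwise c V x : 0 < c ->
  ((`|wpoly c (V - V.[0]%:P) x|)%:E <=
   \int[mu]_t (hardyk (2 * c) x t * `|gpoly c V^`() t|)%:E)%E.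
Proof.
move=> c0; rewrite /wpoly normrM gpoly_norm hornerD hornerN hornerC.
rewrite (@ger0_norm _ (1 + `|x|)) ?addr_ge0 // mulrCA mulrC.
apply: (@increment_le_integral _ (horner V) (horner V^`())).
- exact: continuous_horner.
- exact: measurable_hardyk_gpoly.
- by move=> t; rewrite mulr_ge0 ?hardyk_ge0.
- by rewrite mulr_ge0 ?expR_ge0 ?addr_ge0.
move=> t txy.
have [xt tx] : 0 <= x * t /\ `|t| <= `|x|.
  move: txy; have [x0|x0] := leP 0 x.
    by move=> /andP[t0 tx]; rewrite mulr_ge0 // !ger0_norm.
  move=> /andP[xt t0].
  by rewrite (ler0_norm t0) (ltr0_norm x0) lerN2; split => //; nra.
rewrite gpoly_norm /hardyk normr_sqrB //.
have -> : - (2 * c / 2 * (x ^+ 2 - t ^+ 2)) = - (c * x ^+ 2) + c * t ^+ 2 by field.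
rewrite expRD.
have E : expR (c * t ^+ 2) * expR (- (c * t ^+ 2)) = 1 by rewrite -expRD subrr expR0.
rewrite -[leRHS]mulrA [X in _ <= _ * X]mulrA.
have -> : expR (- (c * x ^+ 2)) * expR (c * t ^+ 2) * `|(V^`()).[t]| *
    expR (- (c * t ^+ 2)) = expR (- (c * x ^+ 2)) * `|(V^`()).[t]|.
  by rewrite -[RHS]mulr1 -E; ring.
rewrite -mulrA ler_wpM2r ?mulr_ge0 ?expR_ge0 //.
by rewrite lerDl.
Qed.

(** V e^(- x^2 / 2) vanishes at infinity, hence is the integral of its derivative
    (V' - X V) e^(- t^2 / 2) over the half line that starts at x and points away
    from the origin. The half line is truncated at a far point y, where the
    boundary term is below e. *)
Lemma hardy_infty_pointwise c V x : 0 < c -> c < 2^-1 ->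
  ((`|wpoly c V x|)%:E <=
   \int[mu]_t (hardyk (1 - 2 * c) x t * `|gpoly c (gderiv 2^-1 V) t|)%:E)%E.
Proof.
move=> c0 c12; apply/lee_addgt0Pr => e e0.
pose a := (1 + `|x|) * expR ((2^-1 - c) * x ^+ 2).
have a0 : 0 < a by rewrite mulr_gt0 ?expR_gt0 // ltr_pwDl.
have half0 : 0 < 2^-1 :> R by rewrite invr_gt0.
have [M M0 HM] := gpoly_small V half0 (divr_gt0 e0 a0).
pose y := if 0 <= x then `|x| + M else - (`|x| + M).
have yM : M <= `|y|.
  rewrite /y; case: ifP => _; rewrite ?normrN ger0_norm ?lerDr //;
  by rewrite addr_ge0 // ltW.
have -> : `|wpoly c V x| = a * `|gpoly 2^-1 V x|.
  rewrite /wpoly /a normrM !gpoly_norm (@ger0_norm _ (1 + `|x|)) ?addr_ge0 //.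
  have -> : - (c * x ^+ 2) = (2^-1 - c) * x ^+ 2 - 2^-1 * x ^+ 2 by field.
  by rewrite expRD; ring.
have Hy : a * `|gpoly 2^-1 V y| <= e.
  by rewrite mulrC -ler_pdivlMr // HM.
apply: (@le_trans _ _ ((a * `|gpoly 2^-1 V x - gpoly 2^-1 V y|)%:E +
                       (a * `|gpoly 2^-1 V y|)%:E)%E).
  rewrite -EFinD lee_fin -mulrDr ler_wpM2l ?(ltW a0) //.
  by rewrite -{1}(subrK (gpoly 2^-1 V y) (gpoly 2^-1 V x)) ler_normD.
rewrite leeD ?lee_fin //.
apply: (@increment_le_integral _ (gpoly 2^-1 V) (gpoly 2^-1 (gderiv 2^-1 V))).
- by move=> t; exact: is_derive_gpoly.
- exact: continuous_gpoly.
- exact: measurable_hardyk_gpoly.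
- by move=> t; rewrite mulr_ge0 ?hardyk_ge0.
- exact: ltW.
move=> t txy.
have [xt tx] : 0 <= t * x /\ `|x| <= `|t|.
  move: txy; rewrite /y; case: ifP => x0.
    have xM : x < `|x| + M by rewrite ger0_norm // ltrDl.
    rewrite minElt maxElt xM => /andP[xt _].
    have t0 := le_trans x0 xt.
    by rewrite mulr_ge0 // !ger0_norm.
  have {}x0 : x < 0 by rewrite ltNge x0.
  rewrite ltr0_norm // opprD opprK.
  have xM : ~~ (x < x - M) by rewrite -leNgt gerBl ltW.
  rewrite minElt maxElt (negbTE xM) => /andP[_ tx].
  by rewrite !ltr0_norm //; [split; nra|exact: le_lt_trans tx x0].
rewrite !gpoly_norm hardykC /hardyk normr_sqrB // /a.
have -> : - ((1 - 2 * c) / 2 * (t ^+ 2 - x ^+ 2)) =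
    (2^-1 - c) * x ^+ 2 - (2^-1 - c) * t ^+ 2 by field.
rewrite expRD.
have -> : - (2^-1 * t ^+ 2) = - ((2^-1 - c) * t ^+ 2) - c * t ^+ 2 by field.
rewrite [expR (- _ - _)]expRD.
set e1 := expR ((2^-1 - c) * _); set e2 := expR (- _); set e3 := expR (- _).
set w := `|_.[t]|.
have -> : (1 + `|x|) * e1 * (w * (e2 * e3)) = (1 + `|x|) * (e1 * e2 * (w * e3)) by ring.
rewrite -[leRHS]mulrA ler_wpM2r ?mulr_ge0 ?expR_ge0 ?normr_ge0 //.
by rewrite addrAC lerDl.
Qed.

Lemma hardy_infty p : 1 < p -> let c := (2 * p)^-1 in
  exists2 A : R, 0 <= A & forall V,
  (Lp p (wpoly c V) <= A%:E * Lp p (gpoly c (gderiv 2^-1 V)))%E.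
Proof.
move=> p1 c; have p0 : 0 < p by exact: lt_trans p1.
have c0 : 0 < c by rewrite invr_gt0 mulr_gt0.
have c12 : c < 2^-1 by rewrite /c invfM gtr_pMr ?invr_gt0 // invf_lt1.
have s0 : 0 < 1 - 2 * c by lra.
have [A A0 HA] := integral_hardyk_le s0.
exists A => // V.
apply: (@schur_test _ _ _ (hardyk (1 - 2 * c))) => //.
- exact: hardyk_ge0.
- exact: measurable_hardyk.
- by move=> t; under eq_integral do rewrite hardykC; exact: HA.
- exact: measurable_wpoly.
- exact: measurable_gpoly.
- by move=> x; exact: hardy_infty_pointwise.
Qed.

Lemma hardy_zero p : 1 < p -> let c := (2 * p)^-1 in
  exists2 A : R, 0 <= A & forall V,
  (Lp p (wpoly c (V - V.[0]%:P)) <= A%:E * Lp p (gpoly c V^`()))%E.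
Proof.
move=> p1 c; have p0 : 0 < p by exact: lt_trans p1.
have c0 : 0 < c by rewrite invr_gt0 mulr_gt0.
have s0 : 0 < 2 * c by rewrite mulr_gt0.
have [A A0 HA] := integral_hardyk_le s0.
exists A => // V.
apply: (@schur_test _ _ _ (hardyk (2 * c))) => //.
- exact: hardyk_ge0.
- exact: measurable_hardyk.
- by move=> t; under eq_integral do rewrite hardykC; exact: HA.
- exact: measurable_wpoly.
- exact: measurable_gpoly.
- by move=> x; exact: hardy_zero_pointwise.
Qed.

End HardyInequalities.

(** * The Hardy inequality for polynomials of mean zero *)
Section MeanZero.
Context {R : realType}.
Local Notation mu := (@lebesgue_measure R).
Implicit Types (s c x t : R) (U V P : {poly R}).

Lemma wpoly_decay c P : 0 < c ->
  exists2 C : R, 0 <= C & forall x, `|wpoly c P x| <= C * (1 + x ^+ 2)^-1.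
Proof.
move=> c0; have [C C0 HC] := gpoly_decay ((2%:P + 'X^2) * P) c0.
exists C => // x; apply: le_trans (HC x).
rewrite /wpoly normrM !gpoly_norm hornerM normrM -mulrA.
apply: ler_wpM2r; first by rewrite mulr_ge0 ?expR_ge0.
rewrite !(hornerD, hornerC, hornerXn) ger0_norm ?addr_ge0 //.
apply: le_trans (ler_norm _); rewrite -[x ^+ 2]real_normK ?num_real //.
have := normr_ge0 x; nra.
Qed.

Lemma gint_norm_le P : (`|gint P|%:E <= \int[mu]_t (`|gpoly 2^-1 P t|)%:E)%E.
Proof.
have half0 : 0 < 2^-1 :> R by rewrite invr_gt0.
have hi := integrable_gpoly P half0.
rewrite /gint EFin_normr_Rintegral //.
apply: le_abse_integral => //; exact: (measurable_int mu hi).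
Qed.

(** Since U has mean zero, the constant U(0) is minus the mean of U - U(0),
    hence the constant function is the image of U - U(0) under a kernel of rank
    one with bounded marginals; [hardy_zero] controls U - U(0). *)
Lemma hardy_mean p : 1 < p -> let c := (2 * p)^-1 in
  exists2 A : R, 0 <= A & forall U, gint U = 0 ->
  (Lp p (wpoly c U) <= A%:E * Lp p (gpoly c U^`()))%E.
Proof.
move=> p1 c; have p0 : 0 < p by exact: lt_trans p1.
have c0 : 0 < c by rewrite invr_gt0 mulr_gt0.
have c12 : 0 < 2^-1 - c by rewrite subr_gt0 /c invfM gtr_pMr ?invr_gt0 // invf_lt1.
have [A A0 HA] := hardy_zero p1.
have [C1 C10 H1] := wpoly_decay 1 c0.
have [C2 C20 H2] := gpoly_decay 1 c12.
have g0 := @gint1_gt0 R.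
pose k x t := (gint 1)^-1 * (wpoly c 1 x * gpoly (2^-1 - c) 1 t).
pose D := (gint 1)^-1 * (C1 * C2).
have D0 : 0 <= D by rewrite !mulr_ge0 // invr_ge0 ltW.
have w0 x : 0 <= wpoly c 1 x.
  by rewrite /wpoly /gpoly hornerC mul1r mulr_ge0 ?expR_ge0 // addr_ge0.
have u0 t : 0 <= gpoly (2^-1 - c) 1 t by rewrite /gpoly hornerC mul1r expR_ge0.
have k0 x t : 0 <= k x t by apply: mulr_ge0; [rewrite invr_ge0 ltW|exact: mulr_ge0].
have I1 (x : R) : 0 < (1 + x ^+ 2)^-1 <= 1.
  rewrite invr_gt0 ltr_pwDl ?sqr_ge0 //=.
  by rewrite invf_le1 ?ltr_pwDl ?sqr_ge0 // lerDl sqr_ge0.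
have kD x t : k x t <= D * ((1 + x ^+ 2)^-1 * (1 + t ^+ 2)^-1).
  rewrite /k /D -[leRHS]mulrA ler_wpM2l ?invr_ge0 ?(ltW g0) //.
  rewrite [leRHS]mulrACA; apply: ler_pM; [exact: w0|exact: u0| |].
    by apply: le_trans (H1 x); rewrite ler_norm.
  by apply: le_trans (H2 t); rewrite ler_norm.
have mk : measurable_fun setT (fun z : R * R => k z.1 z.2).
  apply: measurable_funM => //; apply: measurable_funM.
    exact: (measurableT_comp (measurable_wpoly c 1) (@measurable_fst _ _ _ _)).
  exact: (measurableT_comp (measurable_gpoly _ 1) (@measurable_snd _ _ _ _)).
exists ((1 + D * pi) * A); first by rewrite mulr_ge0 // addr_ge0 // mulr_ge0 // pi_ge0.
move=> U U0.
set v := U - U.[0]%:P.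
have const : (Lp p (wpoly c U.[0]%:P) <= (D * pi)%:E * Lp p (wpoly c v))%E.
  apply: (@schur_test _ _ _ k) => //; try exact: measurable_wpoly.
  - by rewrite mulr_ge0 // pi_ge0.
  - move=> x; apply: integral_decay_le => //.
      exact: (measurableT_comp mk (pair1_measurable x)).
    move=> t; apply: le_trans (kD x t) _; rewrite ler_wpM2l //.
    have /andP[] := I1 x; have /andP[] := I1 t => ? ? ? ?.
    by rewrite ler_piMl // ltW.
  - move=> t; apply: integral_decay_le => //.
      exact: (measurableT_comp mk (pair2_measurable t)).
    move=> x; apply: le_trans (kD x t) _; rewrite ler_wpM2l //.
    have /andP[] := I1 x; have /andP[] := I1 t => ? ? ? ?.
    by rewrite ler_piMr // ltW.
  - move=> x.
    have -> : `|wpoly c U.[0]%:P x| = ((gint 1)^-1 * wpoly c 1 x) * `|gint v|.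
      have -> : gint v = - (U.[0] * gint 1).
        by rewrite /v gintB U0 sub0r -[_%:P]mulr1 mul_polyC gintZ.
      rewrite normrN [`|_ * gint 1|]normrM (ger0_norm (ltW g0)) /wpoly normrM ger0_norm ?addr_ge0 //.
      rewrite !gpoly_norm /gpoly !hornerC.
      by field; rewrite gt_eqF.
    have a0 : 0 <= (gint 1)^-1 * wpoly c 1 x by rewrite mulr_ge0 // invr_ge0 ltW.
    rewrite EFinM.
    apply: (le_trans (lee_wpmul2l _ (gint_norm_le v))); first by rewrite lee_fin.
    have mg : measurable_fun setT (fun t => `|gpoly 2^-1 v t|).
      by apply: measurableT_comp => //; exact: measurable_gpoly.
    rewrite -ge0_integralZl ?lee_fin //; last by apply/measurable_EFinP; exact: mg.
    apply: ge0_le_integral => //.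
    + by move=> t _; rewrite -EFinM lee_fin mulr_ge0.
    + by apply/measurable_EFinP; exact: measurable_funM.
    + apply/measurable_EFinP; apply: measurable_funM.
        exact: (measurableT_comp mk (pair1_measurable x)).
      by apply: measurableT_comp => //; exact: measurable_wpoly.
    + move=> t _; rewrite -EFinM lee_fin.
      have -> : gpoly 2^-1 v t = gpoly (2^-1 - c) 1 t * gpoly c v t.
        by rewrite gpolyM mul1r subrK.
      rewrite [`|_ * gpoly c v t|]normrM (ger0_norm (u0 t)).
      have -> : (gint 1)^-1 * wpoly c 1 x * (gpoly (2^-1 - c) 1 t * `|gpoly c v t|) =
          k x t * `|gpoly c v t| by rewrite /k; ring.
      apply: ler_wpM2l; first exact: k0.
      by rewrite /wpoly [leRHS]normrM ler_peMl // ger0_norm ?addr_ge0 // lerDl.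
apply: (@le_trans _ _ (1%:E * Lp p (wpoly c v) + 1%:E * Lp p (wpoly c U.[0]%:P))%E).
  apply: Lp_triangle => //; try exact: measurable_wpoly.
    exact: ltW.
  move=> x; rewrite !mul1r; apply: le_trans (ler_normD _ _).
  by rewrite /wpoly -mulrDr -gpolyD /v subrK.
rewrite !mul1e.
apply: (le_trans (leeD2l _ const)).
have Dpi0 : 0 <= D * pi by rewrite mulr_ge0 // pi_ge0.
rewrite -[X in (X + _)%E]mul1e -ge0_muleDl ?lee_fin //.
rewrite -EFinD EFinM -muleA; apply: lee_wpmul2l; last exact: HA.
by rewrite lee_fin addr_ge0.
Qed.

End MeanZero.

(** * Taylor polynomials of the exponential and of the cosine *)
Section TruncatedSeries.
Context {R : realType}.
Implicit Types (v z w : R) (n N : nat).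

Definition expoly n : {poly R} := \poly_(k < n) (k`!%:R)^-1.

(** Taylor polynomial of (1 - cos v) / v^2. *)
Definition versinpoly n : {poly R} :=
  \sum_(j < n) ((-1) ^+ j / (j.*2.+2)`!%:R) *: 'X^(j.*2).

Lemma horner_expoly n z : (expoly n).[z] = \sum_(0 <= k < n) z ^+ k / k`!%:R.
Proof.
by rewrite horner_poly big_mkord; apply: eq_bigr => k _; rewrite mulrC.
Qed.

Lemma horner_expolyS n z :
  (expoly n.+1).[z] = (expoly n).[z] + z ^+ n / n`!%:R.
Proof. by rewrite !horner_expoly big_nat_recr. Qed.

Lemma exp_term_ge0 n z : 0 <= z -> 0 <= z ^+ n / n`!%:R.
Proof. by move=> z0; rewrite divr_ge0 // exprn_ge0. Qed.

Lemma expoly_ge0 n z : 0 <= z -> 0 <= (expoly n).[z].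
Proof.
by move=> z0; rewrite horner_expoly; apply: sumr_ge0 => k _; exact: exp_term_ge0.
Qed.

Lemma expoly_cvg z : (expoly n).[z] @[n --> \oo] --> expR z.
Proof.
rewrite (_ : (fun n => (expoly n).[z]) = series (exp_coeff z)); last first.
  by apply/funext => n; rewrite horner_expoly.
exact: (@is_cvg_series_exp_coeff R z).
Qed.

Lemma expoly_nondecreasing m n z : 0 <= z -> (m <= n)%N ->
  (expoly m).[z] <= (expoly n).[z].
Proof.
move=> z0; elim: n => [|n IH]; first by rewrite leqn0 => /eqP ->.
rewrite leq_eqVlt => /predU1P[->//|]; rewrite ltnS => /IH /le_trans; apply.
by rewrite horner_expolyS lerDl exp_term_ge0.
Qed.

Lemma expoly_le n z : 0 <= z -> (expoly n).[z] <= expR z.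
Proof.
move=> z0; apply: (cvgr_to_ge (@expoly_cvg z)).
near=> m; apply: expoly_nondecreasing => //.
by near: m; exact: nbhs_infty_ge.
Unshelve. all: by end_near. Qed.

(** Compared with [expoly_le], half of the exponential is traded for a factor
    2 ^ n; times e^(- z) this still decays exponentially in z. *)
Lemma expoly_le_half n z : 0 <= z -> (expoly n).[z] <= 2 ^+ n * expR (z / 2).
Proof.
move=> z0; apply: (@le_trans _ _ (2 ^+ n * (expoly n).[z / 2])); last first.
  by rewrite ler_pM2l ?exprn_gt0 // expoly_le // divr_ge0.
rewrite !horner_expoly mulr_sumr !big_mkord; apply: ler_sum => k _.
rewrite expr_div_n mulrA ler_wpM2r ?invr_ge0 // mulrCA ler_peMr ?exprn_ge0 //.
by rewrite ler_pdivlMr ?exprn_gt0 // mul1r ler_weXn2l ?ler1n // ltnW.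
Qed.

(** In the tail, z^k <= (2 z)^k / 2^n. *)
Lemma expoly_ge n z : 0 <= z -> expR z - expR (2 * z) / 2 ^+ n <= (expoly n).[z].
Proof.
move=> z0; rewrite lerBlDr.
apply: (cvgr_to_le (@expoly_cvg z)).
near=> m.
have nm : (n <= m)%N by near: m; exact: nbhs_infty_ge.
rewrite !horner_expoly (big_cat_nat _ nm) //= lerD2l.
have zz : 0 <= 2 * z by exact: mulr_ge0.
rewrite ler_pdivlMr ?exprn_gt0 //.
apply: le_trans (expoly_le m zz).
rewrite horner_expoly [leRHS](big_cat_nat _ nm) //=.
rewrite -[leLHS]add0r lerD //.
  by apply: sumr_ge0 => k _; exact: exp_term_ge0.
rewrite mulr_suml; apply: ler_sum_nat => k /andP[nk _].
rewrite exprMn mulrAC ler_wpM2r ?invr_ge0 // mulrC ler_wpM2r ?exprn_ge0 //.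
by rewrite ler_weXn2l // ler1n.
Unshelve. all: by end_near. Qed.

Lemma even_terms_le N w : 0 <= w ->
  \sum_(0 <= j < N) w ^+ j.*2 / (j.*2)`!%:R <= (expoly N.*2).[w].
Proof.
move=> w0; elim: N => [|N IH]; first by rewrite big_geq // expoly_ge0.
rewrite big_nat_recr //= doubleS !horner_expolyS -addrA lerD //.
by rewrite lerDl exp_term_ge0.
Qed.

(** The remainder of the cosine series is bounded as in [expoly_ge], the factor
    2 ^ (2 n) coming from the degrees, all larger than 2 n. *)
Lemma truncated_cos_le n v :
  `|\sum_(0 <= j < n.+1) (-1) ^+ j * v ^+ j.*2 / (j.*2)`!%:R| <=
  1 + expR (2 * `|v|) / 2 ^+ n.*2.
Proof.
have c := @cvg_cos_coeff' R v.
pose C N := \sum_(0 <= j < N) (-1) ^+ j * v ^+ j.*2 / (j.*2)`!%:R.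
have cC : C N @[N --> \oo] --> cos v by exact: c.
rewrite -/(C n.+1).
have w0 : 0 <= 2 * `|v| by rewrite mulr_ge0.
suff : `|C n.+1 - cos v| <= expR (2 * `|v|) / 2 ^+ n.*2.
  have := cos_le1 v; have := cos_geN1 v => ? ? H.
  rewrite -{1}(subrK (cos v) (C n.+1)) (le_trans (ler_normD _ _)) // addrC lerD //.
  by rewrite ler_norml; apply/andP.
have cD : `|C n.+1 - C N| @[N --> \oo] --> `|C n.+1 - cos v|.
  by apply: cvg_norm; apply: cvgB => //; exact: cvg_cst.
apply: (cvgr_to_le cD).
near=> N.
have nN : (n.+1 <= N)%N by near: N; exact: nbhs_infty_ge.
rewrite /C (big_cat_nat _ nN) //= opprD addrA subrr add0r normrN.
rewrite ler_pdivlMr ?exprn_gt0 //.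
apply: le_trans (expoly_le N.*2 w0).
apply: le_trans (even_terms_le N w0).
rewrite [leRHS](big_cat_nat _ nN) //= -[leLHS]add0r lerD //.
  by apply: sumr_ge0 => k _; exact: exp_term_ge0.
apply: (@le_trans _ _ ((\sum_(n.+1 <= j < N) `|v| ^+ j.*2 / (j.*2)`!%:R) * 2 ^+ n.*2)).
  rewrite ler_wpM2r ?exprn_ge0 //; apply: le_trans (ler_norm_sum _ _ _) _.
  apply: ler_sum => j _; rewrite !normrM normrX normrN1 expr1n mul1r normrX.
  by rewrite [`|_^-1|]ger0_norm ?invr_ge0.
rewrite mulr_suml; apply: ler_sum_nat => k /andP[nk _].
rewrite exprMn mulrAC ler_wpM2r ?invr_ge0 // mulrC ler_wpM2r ?exprn_ge0 //.
by rewrite ler_weXn2l ?ler1n // leq_double ltnW.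
Unshelve. all: by end_near. Qed.

Lemma horner_versinpoly n v : (versinpoly n).[v] =
  \sum_(0 <= j < n) (-1) ^+ j * v ^+ j.*2 / (j.*2.+2)`!%:R.
Proof.
rewrite /versinpoly horner_sum big_mkord; apply: eq_bigr => j _.
by rewrite hornerZ hornerXn mulrAC.
Qed.

Lemma sqr_versinpoly n v : v ^+ 2 * (versinpoly n).[v] =
  1 - \sum_(0 <= j < n.+1) (-1) ^+ j * v ^+ j.*2 / (j.*2)`!%:R.
Proof.
rewrite big_nat_recl // /= expr0 expr0 mulr1 fact0 divr1 opprD addrA subrr add0r.
rewrite horner_versinpoly mulr_sumr -sumrN; apply: eq_bigr => j _.
by rewrite doubleS !exprS; ring.
Qed.

Lemma fact_double_ge j : (2 * 4 ^ j <= (j.*2.+2)`!)%N.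
Proof.
elim: j => [//|j IH]; rewrite doubleS (factS j.*2.+3) (factS j.*2.+2) expnS.
rewrite mulnCA [leqRHS]mulnA; apply: leq_mul IH.
by apply: (@leq_mul 4 1).
Qed.

Lemma versinpoly_half n v : `|v| <= 1 ->
  `|(versinpoly n.+1).[v] - 2^-1| <= 6^-1 * (1 - 4^-1 ^+ n).
Proof.
move=> v1; elim: n => [|n IH].
  rewrite horner_versinpoly big_nat1 !expr0 mulr1 div1r.
  by rewrite subrr normr0 subrr mulr0.
rewrite horner_versinpoly big_nat_recr //= -horner_versinpoly.
rewrite addrAC; apply: (le_trans (ler_normD _ _)).
have T : `|(-1) ^+ n.+1 * v ^+ n.+1.*2 / (n.+1.*2.+2)`!%:R| <= 2^-1 * 4^-1 ^+ n.+1.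
  rewrite -mulrA normrM normrX normrN1 expr1n mul1r normrM normrX.
  rewrite [`|_^-1|]ger0_norm ?invr_ge0 //.
  apply: (@le_trans _ _ (1 * ((n.+1.*2.+2)`!%:R)^-1)).
    by rewrite ler_wpM2r ?invr_ge0 // exprn_ile1.
  rewrite mul1r exprVn -invfM lef_pV2 ?posrE ?mulr_gt0 ?exprn_gt0 ?ltr0n ?fact_gt0 //.
  by rewrite -natrX -natrM ler_nat fact_double_ge.
apply: (le_trans (lerD IH T)).
rewrite exprS le_eqVlt; apply/orP; left; apply/eqP.
by field.
Qed.

Lemma versinpoly_range n v : (0 < n)%N -> `|v| <= 1 ->
  3^-1 <= (versinpoly n).[v] <= 1.
Proof.
case: n => // n _ v1; have := versinpoly_half n v1.
have : 0 <= 4^-1 ^+ n :> R by rewrite exprn_ge0.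
rewrite ler_norml => H /andP[]; set q := _ ^+ n in H *; move=> H1 H2.
by apply/andP; split; lra.
Qed.

End TruncatedSeries.

(** * A nonnegative polynomial kernel concentrated near a point *)
Section Kernel.
Context {R : realType}.
Local Notation mu := (@lebesgue_measure R).
Implicit Types (v z b tau c x y t : R) (n : nat) (U : {poly R}).

(** The truncated exponential times e^(- z): it stays close to 1 for z at most
    a small multiple of n and decays exponentially for large z. *)
Definition damp n z : R := (expoly n).[z] * expR (- z).

Lemma damp_ge0 n z : 0 <= z -> 0 <= damp n z.
Proof. by move=> z0; rewrite mulr_ge0 ?expR_ge0 // expoly_ge0. Qed.

Lemma damp_le1 n z : 0 <= z -> damp n z <= 1.
Proof.
by move=> z0; rewrite /damp expRN ler_pdivrMr ?expR_gt0 // mul1r expoly_le.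
Qed.

Lemma damp_le_half n z : 0 <= z -> damp n z <= 2 ^+ n * expR (- (z / 2)).
Proof.
move=> z0; have -> : - (z / 2) = z / 2 - z by field.
by rewrite expRD mulrA ler_wpM2r ?expR_ge0 // expoly_le_half.
Qed.

Lemma damp_ge_third n z : (0 < n)%N -> 0 <= z -> z <= n%:R / 8 -> 3^-1 <= damp n z.
Proof.
move=> n0 z0 zn.
apply: (@le_trans _ _ (1 - expR z / 2 ^+ n)); last first.
  have := expoly_ge n z0; rewrite -(ler_pM2r (expR_gt0 (- z))) => /(le_trans _); apply.
  rewrite mulrBl expRxMexpNx_1 lerD2l lerN2 mulrAC -expRD.
  by have -> : 2 * z - z = z by ring.
have e43 : expR 8^-1 <= 4 / 3 :> R.
  rewrite -[expR _]invrK -expRN invf_ple ?posrE ?expR_gt0 ?divr_gt0 //.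
  by apply: le_trans (expR_ge1Dx _); lra.
have : expR z / 2 ^+ n <= 2 / 3.
  apply: (@le_trans _ _ ((2 / 3) ^+ n)); last first.
    by rewrite -(prednK n0) exprS ler_piMr ?exprn_ile1 //; lra.
  rewrite ler_pdivrMr ?exprn_gt0 // -exprMn.
  have -> : 2 / 3 * 2 = 4 / 3 :> R by field.
  apply: (@le_trans _ _ (expR 8^-1 ^+ n)).
    by rewrite -expRM_natl ler_expR.
  by rewrite lerXn2r ?nnegrE ?expR_ge0 // divr_ge0.
lra.
Qed.

(** For |v| <= 1 both factors are at most 1. Otherwise
    v^2 S = 1 - C with C a truncated cosine, and the only possibly large part of C
    is its remainder e^(2 |v|) / 4^n; its square is compensated by the
    factor 2^n e^(- z / 2) of [damp_le_half] as soon as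
    4 |v| - z / 2 <= n / 2, because e^(1/2) <= 8. *)
Lemma kernel_upper n v z : (0 < n)%N -> 0 <= z -> 4 * `|v| - z / 2 <= n%:R / 2 ->
  (versinpoly n).[v] ^+ 2 * damp n z * (1 + v ^+ 2) ^+ 2 <= 40.
Proof.
move=> n0 z0 H; set S := (versinpoly n).[v]; set a := damp n z.
have a0 : 0 <= a by exact: damp_ge0.
have a1 : a <= 1 by exact: damp_le1.
have v2 : 0 <= v ^+ 2 by exact: sqr_ge0.
have [v1|v1] := leP (`|v|) 1.
  have /andP[S0 S1] := versinpoly_range n0 v1.
  have v21 : v ^+ 2 <= 1 by rewrite -(real_normK (num_real v)) expr_le1.
  rewrite -/S in S0 S1.
  have h1 : S ^+ 2 <= 1 by rewrite expr_le1 //; lra.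
  have h2 : (1 + v ^+ 2) ^+ 2 <= 4 by nra.
  have h3 : S ^+ 2 * a <= 1.
    by rewrite -[leRHS]mul1r ler_pM // sqr_ge0.
  apply: (@le_trans _ _ (1 * 4)); last by lra.
  by apply: ler_pM; rewrite ?sqr_ge0 // mulr_ge0 ?sqr_ge0 //.
have v21 : 1 <= v ^+ 2 by rewrite -(real_normK (num_real v)) exprn_ege1 // ltW.
set d := expR (2 * `|v|) / 2 ^+ n.*2.
have d0 : 0 <= d by rewrite divr_ge0 ?expR_ge0 // exprn_ge0.
have vS : `|v ^+ 2 * S| <= 2 + d.
  rewrite sqr_versinpoly (le_trans (ler_normB _ _)) // normr1.
  by have := truncated_cos_le n v; rewrite -/d; lra.
have da : d ^+ 2 * a <= 1.
  have -> : d ^+ 2 = expR (4 * `|v|) / (2 ^+ n * 8 ^+ n).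
    rewrite /d expr_div_n -expRM_natl -!exprMn -exprM; congr (expR _ / _).
      by rewrite mulrA -natrM.
    have -> : 2 * 8 = 2 ^+ 4 :> R by ring.
    by rewrite -exprM -muln2 -mulnA mulnC.
  apply: (@le_trans _ _ (expR (4 * `|v|) / (2 ^+ n * 8 ^+ n) * (2 ^+ n * expR (- (z / 2))))).
    apply: ler_wpM2l; last exact: damp_le_half.
    by apply: divr_ge0; rewrite ?expR_ge0 ?mulr_ge0 ?exprn_ge0.
  have -> : expR (4 * `|v|) / (2 ^+ n * 8 ^+ n) * (2 ^+ n * expR (- (z / 2))) =
      expR (4 * `|v|) * expR (- (z / 2)) / 8 ^+ n.
    by field; rewrite !expf_neq0.
  rewrite -expRD ler_pdivrMr ?exprn_gt0 // mul1r.
  apply: (@le_trans _ _ (expR (n%:R * 2^-1))); first by rewrite ler_expR.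
  rewrite expRM_natl lerXn2r ?nnegrE ?expR_ge0 //.
  rewrite -[expR _]invrK -expRN invf_ple ?posrE ?expR_gt0 //.
  by apply: le_trans (expR_ge1Dx _); lra.
have K : (v ^+ 2 * S) ^+ 2 * a <= 10.
  have h1 : (v ^+ 2 * S) ^+ 2 <= 8 + 2 * d ^+ 2.
    apply: (@le_trans _ _ ((2 + d) ^+ 2)).
      by rewrite -(real_normK (num_real (_ * S))) lerXn2r ?nnegrE ?addr_ge0.
    by have := sqr_ge0 (2 - d); nra.
  apply: (@le_trans _ _ ((8 + 2 * d ^+ 2) * a)); first by rewrite ler_wpM2r.
  nra.
have h4 : (1 + v ^+ 2) ^+ 2 <= 4 * (v ^+ 2) ^+ 2 by nra.
apply: (@le_trans _ _ (S ^+ 2 * a * (4 * (v ^+ 2) ^+ 2))).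
  by rewrite ler_wpM2l // mulr_ge0 // sqr_ge0.
have -> : S ^+ 2 * a * (4 * (v ^+ 2) ^+ 2) = 4 * ((v ^+ 2 * S) ^+ 2 * a) by ring.
lra.
Qed.

Lemma kernel_lower n v z : (0 < n)%N -> 0 <= z -> z <= n%:R / 8 -> `|v| <= 1 ->
  27^-1 <= (versinpoly n).[v] ^+ 2 * damp n z.
Proof.
move=> n0 z0 zn v1; have /andP[S0 _] := versinpoly_range n0 v1.
have a0 := damp_ge_third n0 z0 zn.
have -> : 27^-1 = 3^-1 ^+ 2 * 3^-1 :> R by field.
apply: ler_pM; [by rewrite sqr_ge0|by rewrite invr_ge0| |exact: a0].
by rewrite lerXn2r // nnegrE; lra.
Qed.

(** Times e^(- b y^2), this is a Fejer-type kernel around x of width 1 / tau. It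
    is a polynomial in y of degree less than 6 n, and the exponential
    polynomial makes it harmless where tau (x - y) is too large for the Taylor
    polynomial of the cosine to be accurate. *)
Definition kerpoly n tau b x : {poly R} :=
  tau *: ((versinpoly n \Po (tau *: (x%:P - 'X))) ^+ 2 * (expoly n \Po (b *: 'X^2))).

Lemma gpoly_kerpoly n tau b x y : gpoly b (kerpoly n tau b x) y =
  tau * ((versinpoly n).[tau * (x - y)] ^+ 2 * damp n (b * y ^+ 2)).
Proof.
rewrite /gpoly /kerpoly /damp hornerZ hornerM horner_exp !horner_comp !hornerZ.
by rewrite hornerD hornerN hornerC hornerX hornerXn; ring.
Qed.

Lemma size_kerpoly n tau b x : (0 < n)%N -> (size (kerpoly n tau b x) <= 6 * n)%N.
Proof.
move=> n0; apply: leq_trans (size_scale_leq _ _) _.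
have sS : (size (versinpoly (R:=R) n) <= n.*2)%N.
  apply: leq_trans (size_sum _ _ _) _; apply/bigmax_leqP => j _.
  by apply: leq_trans (size_scale_leq _ _) _; rewrite size_polyXn; have := ltn_ord j; lia.
have sE : (size (expoly (R:=R) n) <= n)%N by exact: size_poly.
have s1 : (size (tau *: (x%:P - 'X)) <= 2)%N.
  apply: leq_trans (size_scale_leq _ _) _; apply: leq_trans (size_polyD _ _) _.
  by rewrite size_polyN size_polyX geq_max (leq_trans (size_polyC_leq1 _)).
have s2 : (size (b *: 'X^2 : {poly R}) <= 3)%N.
  by apply: leq_trans (size_scale_leq _ _) _; rewrite size_polyXn.
have l1 : (size (versinpoly n \Po (tau *: (x%:P - 'X))) <= (n.*2.-1).+1)%N.
  apply: leq_trans (size_comp_poly_leq _ _) _; rewrite ltnS -[leqRHS]muln1.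
  by apply: leq_mul; [case: (size _) sS|case: (size _) s1]; lia.
have l2 : (size (expoly n \Po (b *: 'X^2)) <= (n.-1 * 2).+1)%N.
  apply: leq_trans (size_comp_poly_leq _ _) _; rewrite ltnS.
  by apply: leq_mul; [case: (size _) sE|case: (size _) s2]; lia.
move: (versinpoly n \Po _) (expoly n \Po _) l1 l2 => P Q l1 l2.
apply: leq_trans (size_polyMleq _ _) _; rewrite expr2.
have := size_polyMleq P P.
by move: (size (P * P)) (size P) (size Q) l1 l2 => *; lia.
Qed.

End Kernel.

(** * The local estimate *)
Section LocalEstimate.
Context {R : realType}.
Local Notation mu := (@lebesgue_measure R).
Implicit Types (c b tau x y t : R) (n : nat) (U : {poly R}).

(** On the segment between x and y the Cauchy weight centred at x is smallest
    at y. *)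
Lemma cauchy_increment_le c tau U x y : 0 <= tau ->
  (`|gpoly c U x - gpoly c U y|%:E <= (1 + (tau * (y - x)) ^+ 2)%:E *
   \int[mu]_t ((1 + (tau * (t - x)) ^+ 2)^-1 * `|gpoly c (gderiv c U) t|)%:E)%E.
Proof.
move=> tau0.
have D0 (t : R) : 0 < 1 + (tau * (t - x)) ^+ 2 by rewrite ltr_pwDl // sqr_ge0.
rewrite -lee_pdivrMl ?D0 // -EFinM.
apply: (@increment_le_integral _ (gpoly c U) (gpoly c (gderiv c U))).
- by move=> t; exact: is_derive_gpoly.
- exact: continuous_gpoly.
- apply: measurable_funM.
    by apply: measurable_continuous; exact: continuous_lorentz.
  by apply: measurableT_comp => //; exact: measurable_gpoly.
- by move=> t; rewrite mulr_ge0 // invr_ge0 ltW.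
- by rewrite invr_ge0 ltW.
- move=> t txy; apply: ler_wpM2r => //.
  rewrite lef_pV2 ?posrE // lerD2l -(real_normK (num_real (_ * (t - x)))).
  rewrite -(real_normK (num_real (_ * (y - x)))) lerXn2r ?nnegrE // !normrM.
  apply: ler_wpM2l => //.
  move: txy; have [xy|yx] := leP x y => /andP[h1 h2].
    by rewrite !ger0_norm ?subr_ge0 // ?lerD2r // (le_trans h1 h2).
  by rewrite !ler0_norm ?subr_le0 ?(ltW yx) // lerN2 lerD2r.
Qed.

Definition kermass n tau b x : R := \int[mu]_y gpoly b (kerpoly n tau b x) y.

Definition local_const b : R := 216 * (40 * pi) / b.

Lemma local_const_ge0 b : 0 <= b -> 0 <= local_const b.
Proof.
move=> b0; apply: divr_ge0 b0; apply: mulr_ge0; first exact: ler0n.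
by apply: mulr_ge0; [exact: ler0n|exact: pi_ge0].
Qed.

Section Kernel.
Variables (b : R) (n : nat) (x : R).
Hypotheses (b0 : 0 < b) (b12 : b < 2^-1) (n0 : (0 < n)%N).
Let rn : R := Num.sqrt n%:R.
(* b / 4 is small enough for 4 |v| - z / 2 <= n / 2 to hold for all y when
   |x| <= sqrt n / 4, with v = tau (x - y) and z = b y^2. *)
Let tau : R := b / 4 * rn.
Hypothesis xn : `|x| <= rn / 4.

Let rn1 : 1 <= rn.
Proof. by rewrite -[leLHS]sqrtr1 ler_sqrt // ler1n. Qed.

Let rnE : rn ^+ 2 = n%:R. Proof. by rewrite sqr_sqrtr. Qed.

Let tau0 : 0 < tau.
Proof. by rewrite mulr_gt0 ?divr_gt0 // (lt_le_trans _ rn1). Qed.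

Let z0 y : 0 <= b * y ^+ 2.
Proof. by rewrite mulr_ge0 ?sqr_ge0 // ltW. Qed.

Lemma ker_ge0 y : 0 <= gpoly b (kerpoly n tau b x) y.
Proof.
rewrite gpoly_kerpoly mulr_ge0 ?(ltW tau0) //.
by rewrite mulr_ge0 ?sqr_ge0 // damp_ge0.
Qed.

Lemma ker_upper y : gpoly b (kerpoly n tau b x) y * (1 + (tau * (y - x)) ^+ 2) <=
  40 * (tau / (1 + (tau * (y - x)) ^+ 2)).
Proof.
rewrite gpoly_kerpoly; set v := tau * (x - y).
have -> : (tau * (y - x)) ^+ 2 = v ^+ 2 by rewrite /v; ring.
have D0 : 0 < 1 + v ^+ 2 by rewrite ltr_pwDl // sqr_ge0.
rewrite [leRHS]mulrA ler_pdivlMr //.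
have H : 4 * `|v| - b * y ^+ 2 / 2 <= n%:R / 2.
  have xy : `|v| <= tau * (rn / 4 + `|y|).
    rewrite /v normrM (gtr0_norm tau0) ler_wpM2l ?(ltW tau0) //.
    by apply: le_trans (ler_normB _ _) _; rewrite lerD2r.
  have : 4 * `|v| <= b * rn ^+ 2 / 4 + b * rn * `|y|.
    apply: (@le_trans _ _ (4 * (tau * (rn / 4 + `|y|)))); first by rewrite ler_pM2l.
    by rewrite /tau le_eqVlt; apply/orP; left; apply/eqP; field.
  rewrite -rnE -(real_normK (num_real y)) => h.
  have := mulr_ge0 (ltW b0) (sqr_ge0 (rn - `|y|)).
  have r2 : 0 <= rn ^+ 2 by exact: sqr_ge0.
  have : b * rn ^+ 2 <= 2^-1 * rn ^+ 2 by rewrite ler_wpM2r // ltW.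
  nra.
have K := kernel_upper n0 (z0 y) H.
have -> : tau * ((versinpoly n).[v] ^+ 2 * damp n (b * y ^+ 2)) * (1 + v ^+ 2) * (1 + v ^+ 2) =
  tau * ((versinpoly n).[v] ^+ 2 * damp n (b * y ^+ 2) * (1 + v ^+ 2) ^+ 2) by ring.
by rewrite mulrC ler_wpM2r // ltW.
Qed.

Lemma ker_lower y : `|y - x| <= (4 * rn)^-1 -> tau / 27 <= gpoly b (kerpoly n tau b x) y.
Proof.
move=> yx; rewrite gpoly_kerpoly ler_wpM2l ?(ltW tau0) //.
have r0 : 0 < rn by exact: lt_le_trans rn1.
have ri : (4 * rn)^-1 <= rn / 4.
  by rewrite invfM mulrC ler_wpM2r // (le_trans _ rn1) // invf_le1.
apply: kernel_lower => //.
  have yn : `|y| <= rn / 2.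
    have -> : rn / 2 = rn / 4 + rn / 4 by field.
    rewrite -[y](subrK x); apply: le_trans (ler_normD _ _) _.
    by apply: lerD => //; exact: le_trans yx ri.
  have y2 : y ^+ 2 <= rn ^+ 2 / 4.
    have -> : rn ^+ 2 / 4 = (rn / 2) ^+ 2 by field.
    by rewrite -(real_normK (num_real y)) lerXn2r ?nnegrE // divr_ge0 // ltW.
  have h : b * y ^+ 2 <= 2^-1 * y ^+ 2 by rewrite ler_wpM2r ?sqr_ge0 // ltW.
  rewrite -rnE; apply: (le_trans h).
  by move: (rn ^+ 2) (y ^+ 2) y2 => u w; lra.
rewrite normrM (gtr0_norm tau0) distrC.
apply: (@le_trans _ _ (tau * (4 * rn)^-1)); first by rewrite ler_wpM2l // ltW.
have -> : tau * (4 * rn)^-1 = b / 16 by rewrite /tau; field; rewrite gt_eqF.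
by have := b12; lra.
Qed.

Lemma kermass_ge : b / 216 <= kermass n tau b x.
Proof.
have r0 : 0 < rn by exact: lt_le_trans rn1.
pose r := (4 * rn)^-1; have r00 : 0 < r by rewrite invr_gt0 mulr_gt0.
have ki := integrable_gpoly (kerpoly n tau b x) b0.
rewrite -lee_fin /kermass /Rintegral fineK; last exact: (integrable_fin_num measurableT ki).
apply: (@le_trans _ _ (\int[mu]_(y in `[(x - r)%R, (x + r)%R]) (tau / 27)%:E)%E).
  rewrite integral_cst //= lebesgue_measure_itv /= lte_fin.
  rewrite ifT; last by rewrite ltrD2l gtrN.
  rewrite -EFinD -EFinM lee_fin le_eqVlt; apply/orP; left; apply/eqP.
  by rewrite /r /tau; field; rewrite gt_eqF.
apply: (@le_trans _ _ (\int[mu]_(y in `[(x - r)%R, (x + r)%R]) (gpoly b (kerpoly n tau b x) y)%:E)%E).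
  apply: ge0_le_integral => //.
  - by move=> y _; rewrite lee_fin divr_ge0 // ltW.
  - by apply/measurable_EFinP; apply: measurable_funTS; exact: measurable_gpoly.
  - move=> y /=; rewrite in_itv /= => yI; rewrite lee_fin ker_lower //.
    by rewrite -/r ler_norml; lra.
apply: ge0_subset_integral => //; first exact: (measurable_int mu ki).
by move=> y _; rewrite lee_fin ker_ge0.
Qed.

(** Since b + c = 1/2, the polynomial kernel k times e^(- b y^2) integrates
    psi = U e^(- c y^2) to zero, by orthogonality of U to k. Therefore psi(x) times
    the mass of the kernel is the integral of the kernel against
    psi(x) - psi(y). The increment costs a factor 1 + tau^2 (x - y)^2, and
    one power of the decay of the kernel pays for it. *)
Lemma local_estimate c d U : b = 2^-1 - c -> (6 * n <= d)%N -> gtail d U ->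
  (`|gpoly c U x|%:E <= (local_const b)%:E *
   \int[mu]_t ((1 + (tau * (t - x)) ^+ 2)^-1 * `|gpoly c (gderiv c U) t|)%:E)%E.
Proof.
move=> bc nd HU; set G := (\int[mu]_t _)%E.
have G0 : (0 <= G)%E.
  apply: integral_ge0 => t _; rewrite lee_fin mulr_ge0 // invr_ge0 addr_ge0 //.
  exact: sqr_ge0.
have half0 : 0 < 2^-1 :> R by rewrite invr_gt0.
set k := kerpoly n tau b x.
have ki := integrable_gpoly k b0.
have kUE y : gpoly b k y * gpoly c U y = gpoly 2^-1 (k * U) y.
  by rewrite gpolyM bc subrK.
have kU0 : gint (k * U) = 0.
  by rewrite mulrC; apply: HU; apply: leq_trans (size_kerpoly _ _ _ n0) nd.
have mgU := measurable_gpoly c U.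
have mk := measurable_gpoly b k.
have step1 : (`|kermass n tau b x * gpoly c U x|%:E <=
    \int[mu]_y (gpoly b k y * `|gpoly c U x - gpoly c U y|)%:E)%E.
  have i1 : mu.-integrable setT (EFin \o (fun y => gpoly b k y * gpoly c U x)).
    have := integrableZl measurableT (gpoly c U x) ki.
    by apply: eq_integrable => // y _ /=; rewrite -EFinM mulrC.
  have i2 := integrable_gpoly (k * U) half0.
  have hi : mu.-integrable setT (EFin \o (fun y => gpoly b k y * gpoly c U x - gpoly 2^-1 (k * U) y)).
    exact: eq_integrable (integrableB measurableT i1 i2).
  have -> : kermass n tau b x * gpoly c U x =
      \int[mu]_y (gpoly b k y * gpoly c U x - gpoly 2^-1 (k * U) y).
    rewrite RintegralB //.
    by rewrite RintegralZr // -/(gint _) kU0 subr0.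
  rewrite EFin_normr_Rintegral //.
  apply: le_trans (le_abse_integral mu measurableT (measurable_int mu hi)) _.
  under eq_integral => y _.
    rewrite /= -kUE -mulrBr normrM ger0_norm ?ker_ge0 //; over.
  by [].
have step2 : (\int[mu]_y (gpoly b k y * `|gpoly c U x - gpoly c U y|)%:E <=
    (40 * pi)%:E * G)%E.
  apply: (@le_trans _ _ (\int[mu]_y ((40 * (tau / (1 + (tau * (y - x)) ^+ 2)))%:E * G))%E).
    have mc : measurable_fun setT (fun y => 40 * (tau / (1 + (tau * (y - x)) ^+ 2))).
      by apply: measurable_funM => //; apply: measurable_continuous; exact: continuous_cauchy.
    apply: ge0_le_integral => //.
    - by move=> y _; rewrite lee_fin mulr_ge0 // ker_ge0.
    - apply/measurable_EFinP; apply: measurable_funM => //.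
      by apply: measurableT_comp => //; apply: measurable_funB.
    - by apply: emeasurable_funM => //; apply/measurable_EFinP; exact: mc.
    - move=> y _; rewrite EFinM.
      apply: (@le_trans _ _ ((gpoly b k y)%:E * ((1 + (tau * (y - x)) ^+ 2)%:E * G))%E).
        apply: lee_wpmul2l; first by rewrite lee_fin ker_ge0.
        by apply: cauchy_increment_le; exact: ltW.
      by rewrite muleA -EFinM; apply: lee_wpmul2r => //; rewrite lee_fin ker_upper.
  rewrite ge0_integralZr //.
  - apply: lee_wpmul2r => //; under eq_integral do rewrite EFinM.
    rewrite ge0_integralZl ?lee_fin //.
    + by rewrite EFinM; apply: lee_wpmul2l; rewrite ?lee_fin // integral_cauchy_le.
    + by apply/measurable_EFinP; apply: measurable_continuous; exact: continuous_cauchy.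
    + by move=> y _; rewrite lee_fin cauchy_ge0 // ltW.
  - apply/measurable_EFinP; apply: measurable_funM => //.
    by apply: measurable_continuous; exact: continuous_cauchy.
  - by move=> y _; rewrite lee_fin mulr_ge0 // cauchy_ge0 // ltW.
have := le_trans step1 step2.
rewrite normrM => H.
have -> : local_const b = (b / 216)^-1 * (40 * pi) by rewrite /local_const invf_div mulrAC.
rewrite EFinM -muleA lee_pdivlMl ?divr_gt0 //.
apply: le_trans H; rewrite -EFinM lee_fin ler_wpM2r //.
by apply: le_trans (ler_norm _); exact: kermass_ge.
Qed.

End Kernel.
End LocalEstimate.

(** * The two inequalities for real polynomials *)
Section PolynomialInequalities.
Context {R : realType}.
Local Notation mu := (@lebesgue_measure R).
Implicit Types (c b x y t : R) (n d : nat) (U V : {poly R}).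

Lemma Lp_gpoly_le_wpoly p c U : 0 < p -> (Lp p (gpoly c U) <= Lp p (wpoly c U))%E.
Proof.
move=> p0; rewrite -[leRHS]mul1e; apply: Lp_le => //.
- exact: measurable_gpoly.
- exact: measurable_wpoly.
- move=> x; rewrite mul1r /wpoly [leRHS]normrM ler_peMl //.
  by rewrite ger0_norm ?addr_ge0 // lerDl.
Qed.

Definition cutoff (r : R) (f : R -> R) x : R := \1_(`[- r, r]%classic : set R) x * f x.

Lemma measurable_cutoff r f : measurable_fun setT f -> measurable_fun setT (cutoff r f).
Proof.
by move=> mf; apply: measurable_funM.
Qed.

Lemma cutoff_in r f x : `|x| <= r -> cutoff r f x = f x.
Proof.
by move=> xr; rewrite /cutoff indicE mem_set ?mul1r //= in_itv /= -ler_norml.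
Qed.

Lemma cutoff_out r f x : r < `|x| -> cutoff r f x = 0.
Proof.
move=> xr; rewrite /cutoff indicE memNset ?mul0r //= in_itv /= -ler_norml.
by rewrite leNgt xr.
Qed.

(** Integrating [local_estimate] by the Schur test gains the width of the kernel,
    of order n^(- 1/2). *)
Lemma local_Lp p c n d U : 1 < p -> 0 < c -> c < 2^-1 -> (0 < n)%N ->
  (6 * n <= d)%N -> gtail d U ->
  (Lp p (cutoff (Num.sqrt n%:R / 4) (gpoly c U)) <=
   (local_const (2^-1 - c) * (4 * pi / (2^-1 - c)) / Num.sqrt n%:R)%:E *
   Lp p (gpoly c (gderiv c U)))%E.
Proof.
move=> p1 c0 c12 n0 nd HU; set b := 2^-1 - c; set rn := Num.sqrt n%:R.
have b0 : 0 < b by rewrite subr_gt0.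
have b2 : b < 2^-1 by rewrite gtrBl.
have r0 : 0 < rn by rewrite sqrtr_gt0 ltr0n.
pose tau := b / 4 * rn.
have tau0 : 0 < tau by rewrite mulr_gt0 // divr_gt0.
pose C := local_const b.
have C0 : 0 <= C by apply: local_const_ge0; exact: ltW.
have K0 (x t : R) : 0 <= (1 + (tau * (t - x)) ^+ 2)^-1.
  by rewrite invr_ge0 addr_ge0 // sqr_ge0.
have mI x : measurable_fun setT (fun t => C * (1 + (tau * (t - x)) ^+ 2)^-1).
  apply: measurable_funM => //.
  by apply: measurable_continuous; exact: continuous_lorentz.
have I x : (\int[mu]_t (C * (1 + (tau * (t - x)) ^+ 2)^-1)%:E <=
    (local_const b * (4 * pi / b) / rn)%:E)%E.
  have E t : C * (1 + (tau * (t - x)) ^+ 2)^-1 =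
      C / tau * (tau / (1 + (tau * (t - x)) ^+ 2)).
    by rewrite mulrA divfK // gt_eqF.
  under eq_integral do rewrite E EFinM.
  have Ct0 : 0 <= C / tau by apply: divr_ge0; [exact: C0|exact: ltW].
  rewrite ge0_integralZl ?lee_fin //.
  - have -> : local_const b * (4 * pi / b) / rn = C / tau * pi.
      rewrite -/C /tau.
      by field; rewrite !gt_eqF.
    rewrite [leRHS]EFinM; apply: lee_wpmul2l; last exact: integral_cauchy_le.
    by rewrite lee_fin.
  - by apply/measurable_EFinP; apply: measurable_continuous; exact: continuous_cauchy.
  - by move=> t _; rewrite lee_fin cauchy_ge0 // ltW.
apply: (@schur_test _ _ _ (fun x t => C * (1 + (tau * (t - x)) ^+ 2)^-1)) => //.
- apply: divr_ge0; last exact: ltW.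
  apply: mulr_ge0 => //.
  by apply: divr_ge0; [rewrite mulr_ge0 ?pi_ge0|exact: ltW].
- by move=> x t; exact: mulr_ge0.
- apply: measurable_funM => //.
  have m1 : measurable_fun setT (fun u : R => (1 + (tau * (u - 0)) ^+ 2)^-1).
    by apply: measurable_continuous; exact: continuous_lorentz.
  have m2 : measurable_fun setT (fun z : R * R => z.2 - z.1) by exact: measurable_funB.
  apply: eq_measurable_fun (measurableT_comp m1 m2) => z _ /=.
  by rewrite subr0.
- move=> t; under eq_integral.
    move=> x _.
    have -> : (tau * (t - x)) ^+ 2 = (tau * (x - t)) ^+ 2 by ring.
    over.
  exact: I.
- by apply: measurable_cutoff; exact: measurable_gpoly.
- exact: measurable_gpoly.
move=> x.
have [xn|xn] := leP `|x| (rn / 4); last first.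
  rewrite cutoff_out // normr0; apply: integral_ge0 => t _; rewrite lee_fin.
  by apply: mulr_ge0 => //; exact: mulr_ge0.
rewrite cutoff_in //.
apply: le_trans (local_estimate b0 b2 n0 xn erefl nd HU) _.
rewrite -ge0_integralZl ?lee_fin //.
- by rewrite le_eqVlt; apply/orP; left; apply/eqP; apply: eq_integral => t _; rewrite -EFinM mulrA.
- apply/measurable_EFinP; apply: measurable_funM.
    by apply: measurable_continuous; exact: continuous_lorentz.
  by apply: measurableT_comp => //; exact: measurable_gpoly.
- by move=> t _; rewrite lee_fin mulr_ge0.
Qed.

(** Take n of order d / 6. On |x| <= sqrt n / 4 the local estimate applies, and
    psi' = (U' - 2 c x U) e^(- c x^2) is controlled by U' through [hardy_mean].
    For |x| > sqrt n / 4, [hardy_mean] gains |x|^-1. *)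
Lemma favard_gradient p : 1 < p -> let c := (2 * p)^-1 in
  exists2 S : R, 0 <= S & forall d U, (0 < d)%N -> gtail d U ->
  ((Num.sqrt d%:R)%:E * Lp p (gpoly c U) <= S%:E * Lp p (gpoly c U^`()))%E.
Proof.
move=> p1 c; have p0 : 0 < p by exact: lt_trans p1.
have c0 : 0 < c by rewrite invr_gt0 mulr_gt0.
have c12 : c < 2^-1 by rewrite /c invfM gtr_pMr ?invr_gt0 // invf_lt1.
have [A A0 HA] := hardy_mean p1; rewrite -/c in HA.
pose b := 2^-1 - c; have b0 : 0 < b by rewrite subr_gt0.
pose C := local_const b * (4 * pi / b).
have C0 : 0 <= C.
  apply: mulr_ge0; first by apply: local_const_ge0; exact: ltW.
  by apply: divr_ge0; [rewrite mulr_ge0 ?pi_ge0|exact: ltW].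
pose S := 4 * (C * (1 + 2 * c * A) + 4 * A).
have cA0 : 0 <= 2 * c * A by rewrite !mulr_ge0 // ltW.
have S0 : 0 <= S by rewrite mulr_ge0 // addr_ge0 // mulr_ge0 // addr_ge0.
(* S serves for d >= 6; for d < 6, sqrt d <= 3 and the Hardy inequality suffices. *)
exists (S + 3 * A); first by rewrite addr_ge0 // mulr_ge0.
move=> d U d0 HU.
have U0 : gint U = 0 by case: d d0 HU => // d _; exact: gint_tail.
have HW := HA U U0.
have N0 := Lp_ge0 p (gpoly c U^`()).
have [d6|d6] := ltnP d 6.
  apply: (@le_trans _ _ (3%:E * (A%:E * Lp p (gpoly c U^`())))%E).
    apply: lee_pmul; [by rewrite lee_fin sqrtr_ge0|exact: Lp_ge0| |].
      rewrite lee_fin -[3]ger0_norm // -sqrtr_sqr ler_sqrt ?exprn_ge0 //.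
      by rewrite -natrX ler_nat (leq_trans (ltnW d6)).
    by apply: le_trans (Lp_gpoly_le_wpoly c U p0) HW.
  rewrite muleA -EFinM; apply: lee_wpmul2r => //.
  by rewrite lee_fin lerDr.
pose n := (d %/ 6)%N.
have n0 : (0 < n)%N by rewrite divn_gt0.
have nd : (6 * n <= d)%N by rewrite mulnC leq_divM.
have dn : (d <= 16 * n)%N.
  apply: ltnW; apply: leq_trans (ltn_ceil d (isT : 0 < 6)%N) _.
  rewrite -/n mulSn (mulnC n) (mulnDl 10 6) leq_add2r.
  exact: leq_trans (leq_pmulr 10 n0).
pose rn : R := Num.sqrt n%:R.
have r0 : 0 < rn by rewrite sqrtr_gt0 ltr0n.
have sd : Num.sqrt d%:R <= 4 * rn.
  have -> : 4 * rn = Num.sqrt (16 * n%:R).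
    rewrite sqrtrM // -/rn; congr (_ * _).
    by rewrite (_ : 16 = 4 ^+ 2) ?sqrtr_sqr ?ger0_norm //; ring.
  by rewrite ler_sqrt ?mulr_ge0 // -natrM ler_nat.
have D : (Lp p (gpoly c (gderiv c U)) <= (1 + 2 * c * A)%:E * Lp p (gpoly c U^`()))%E.
  apply: (@le_trans _ _ (1%:E * Lp p (gpoly c U^`()) + (2 * c)%:E * Lp p (wpoly c U))%E).
    apply: Lp_triangle => //.
    - exact: ltW.
    - by rewrite mulr_ge0 // ltW.
    - exact: measurable_gpoly.
    - exact: measurable_gpoly.
    - exact: measurable_wpoly.
    move=> x; rewrite mul1r /gderiv gpolyB gpolyZ gpolyXM.
    apply: le_trans (ler_normB _ _) _; rewrite lerD2l.
    rewrite [`|2 * c * _|]normrM ger0_norm ?mulr_ge0 ?(ltW c0) //.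
    rewrite ler_wpM2l ?mulr_ge0 ?(ltW c0) // /wpoly [leLHS]normrM [leRHS]normrM ler_wpM2r //.
    by rewrite [leRHS]ger0_norm ?addr_ge0 // lerDr.
  rewrite EFinD ge0_muleDl ?lee_fin //; apply: leeD2l.
  rewrite [in leRHS]EFinM -[leRHS]muleA; apply: lee_wpmul2l => //.
  by rewrite lee_fin mulr_ge0 // ltW.
pose u := cutoff (rn / 4) (gpoly c U).
have mu_ : measurable_fun setT u.
  by apply: measurable_cutoff; exact: measurable_gpoly.
have L : (Lp p (gpoly c U) <= 1%:E * Lp p u + (4 / rn)%:E * Lp p (wpoly c U))%E.
  apply: Lp_triangle => //.
  - exact: ltW.
  - by rewrite divr_ge0 // ltW.
  - exact: measurable_gpoly.
  - exact: measurable_wpoly.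
  move=> x; rewrite mul1r /u.
  have h : 0 <= 4 / rn * `|wpoly c U x| by rewrite mulr_ge0 // divr_ge0 // ltW.
  have [xn|xn] := leP `|x| (rn / 4); first by rewrite cutoff_in // lerDl.
  rewrite cutoff_out // normr0 add0r.
  rewrite /wpoly [`|_ * gpoly _ _ _|]normrM mulrA ler_peMl //.
  rewrite ger0_norm ?addr_ge0 // mulrAC ler_pdivlMr // mul1r.
  by move: xn; rewrite ltr_pdivrMr //; lra.
have Lu : (Lp p u <= (C / rn * (1 + 2 * c * A))%:E * Lp p (gpoly c U^`()))%E.
  apply: le_trans (local_Lp p1 c0 c12 n0 nd HU) _.
  rewrite [in leRHS]EFinM -[leRHS]muleA; apply: lee_wpmul2l D.
  by rewrite lee_fin divr_ge0 // ltW.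
have P1 : 0 <= C / rn * (1 + 2 * c * A).
  by apply: mulr_ge0; [apply: divr_ge0 => //; exact: ltW|exact: addr_ge0].
have P2 : 0 <= 4 / rn * A.
  by apply: mulr_ge0 => //; apply: divr_ge0 => //; exact: ltW.
apply: (@le_trans _ _ ((4 * rn)%:E * ((C / rn * (1 + 2 * c * A) + 4 / rn * A)%:E *
    Lp p (gpoly c U^`())))%E).
  apply: lee_pmul; [by rewrite lee_fin sqrtr_ge0|exact: Lp_ge0|by rewrite lee_fin|].
  apply: le_trans L _.
  rewrite EFinD ge0_muleDl ?lee_fin //.
  rewrite mul1e; apply: leeD => //.
  rewrite [in leRHS]EFinM -[leRHS]muleA; apply: lee_wpmul2l => //.
  by rewrite lee_fin divr_ge0 // ltW.
rewrite muleA -EFinM; apply: lee_wpmul2r => //.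
have -> : 4 * rn * (C / rn * (1 + 2 * c * A) + 4 / rn * A) = S.
  by rewrite /S; field; rewrite gt_eqF.
by rewrite lee_fin lerDl mulr_ge0.
Qed.

(** The gradient inequality is applied to U, and then to V = U', which is
    orthogonal to degrees below d - 1. As V' = (V' - X V) + X V, [hardy_infty]
    replaces V' by V' - X V; for d = 1 it bounds V directly. *)
Lemma favard_generator p : 1 < p -> let c := (2 * p)^-1 in
  exists2 T : R, 0 <= T & forall d U, (0 < d)%N -> gtail d U ->
  (d%:R%:E * Lp p (gpoly c U) <= T%:E * Lp p (gpoly c (gderiv 2^-1 U^`())))%E.
Proof.
move=> p1 c; have p0 : 0 < p by exact: lt_trans p1.
have [S S0 HS] := favard_gradient p1; rewrite -/c in HS.
have [B B0 HB] := hardy_infty p1; rewrite -/c in HB.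
exists (S * (2 * (S * (1 + B)) + B)); first by rewrite !(mulr_ge0, addr_ge0).
move=> d U d0 HU; set V := U^`().
set N := Lp p (gpoly c (gderiv 2^-1 V)).
have N0 : (0 <= N)%E by exact: Lp_ge0.
have LV : (Lp p (gpoly c V) <= B%:E * N)%E.
  by apply: le_trans (Lp_gpoly_le_wpoly c V p0) (HB V).
have LV' : (Lp p (gpoly c V^`()) <= (1 + B)%:E * N)%E.
  apply: (@le_trans _ _ (1%:E * N + 1%:E * Lp p (wpoly c V))%E).
    apply: Lp_triangle => //; try exact: measurable_gpoly; try exact: measurable_wpoly.
      exact: ltW.
    move=> x; rewrite !mul1r.
    have -> : V^`() = gderiv 2^-1 V + 'X * V.
      by rewrite /gderiv mulfV // scale1r subrK.
    rewrite gpolyD gpolyXM; apply: le_trans (ler_normD _ _) _; rewrite lerD2l.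
    rewrite /wpoly [leLHS]normrM [leRHS]normrM ler_wpM2r //.
    by rewrite [leRHS]ger0_norm ?addr_ge0 // lerDr.
  rewrite !mul1e EFinD ge0_muleDl ?lee_fin // mul1e; apply: leeD2l; exact: HB.
(* For d >= 2, sqrt d <= 2 sqrt (d - 1). *)
have key : ((Num.sqrt d%:R)%:E * Lp p (gpoly c V) <= (2 * (S * (1 + B)) + B)%:E * N)%E.
  case: d d0 HU => // -[_ _|d _ HU].
    rewrite sqrtr1 mul1e; apply: le_trans LV _; apply: lee_wpmul2r => //.
    by rewrite lee_fin lerDr !mulr_ge0 // addr_ge0.
  have H := HS d.+1 V isT (gtail_deriv HU).
  apply: (@le_trans _ _ (2%:E * ((Num.sqrt d.+1%:R)%:E * Lp p (gpoly c V)))%E).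
    rewrite muleA -EFinM; apply: lee_wpmul2r; first exact: Lp_ge0.
    have -> : 2 * Num.sqrt d.+1%:R = Num.sqrt (4 * d.+1%:R) :> R.
      rewrite sqrtrM // (_ : 4 = 2 ^+ 2) ?sqrtr_sqr ?ger0_norm //; ring.
    by rewrite lee_fin ler_sqrt ?mulr_ge0 // -natrM ler_nat; lia.
  apply: (@le_trans _ _ (2%:E * (S%:E * ((1 + B)%:E * N)))%E).
    apply: lee_wpmul2l => //; apply: le_trans H _; exact: lee_wpmul2l.
  rewrite !muleA -!EFinM; apply: lee_wpmul2r => //.
  by rewrite lee_fin mulrA lerDl.
have -> : (d%:R%:E = (Num.sqrt d%:R)%:E * (Num.sqrt d%:R)%:E :> \bar R)%E.
  by rewrite -EFinM -expr2 sqr_sqrtr.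
rewrite -muleA.
apply: (le_trans (lee_wpmul2l _ (HS d U d0 HU))); first by rewrite lee_fin sqrtr_ge0.
rewrite muleCA EFinM -muleA; exact: lee_wpmul2l.
Qed.

End PolynomialInequalities.

(** * Hermite polynomials *)
Section HermitePolynomials.
Context {R : realType}.
Local Notation mu := (@lebesgue_measure R).
Implicit Types (x y : R) (k n d : nat) (P Q : {poly R}).

Fixpoint hpoly k : {poly R} :=
  if k is k'.+1 then 'X * hpoly k' - (hpoly k')^`() else 1.

Lemma deriv_hpoly k : (hpoly k.+1)^`() = k.+1%:R *: hpoly k.
Proof.
elim: k => [|k IH]; first by rewrite /= mulr1 derivC subr0 derivX scale1r.
rewrite (_ : hpoly k.+2 = 'X * hpoly k.+1 - (hpoly k.+1)^`()) //.
rewrite derivB derivM derivX mul1r IH derivZ -addrA -scalerAr -scalerBr.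
rewrite (_ : 'X * hpoly k - (hpoly k)^`() = hpoly k.+1) //.
by rewrite -[k.+2%:R]natr1 scalerDl scale1r addrC.
Qed.

(** Integration by parts in H_(k+1) Q = X H_k Q - H_k' Q leaves H_k Q'. *)
Lemma gtail_hpoly k : gtail k (hpoly k).
Proof.
elim: k => [|k IH] Q sQ.
  by move: sQ; rewrite leqn0 size_poly_eq0 => /eqP ->; rewrite mulr0 gint0.
rewrite /= mulrBl gintB -mulrA gint_by_parts derivM gintD addrAC subrr add0r.
apply: IH; case: (posnP (size Q)) => [/eqP|sQ0].
  by rewrite size_poly_eq0 => /eqP ->; rewrite deriv0 size_poly0.
by rewrite -ltnS; apply: leq_trans sQ; apply: lt_size_deriv; rewrite -size_poly_gt0.
Qed.

Lemma gtail_sum d n (a : nat -> R) : gtail d (\sum_(d <= k < n) a k *: hpoly k).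
Proof.
move=> Q sQ; rewrite mulr_suml gint_sum big_nat_cond big1 // => k /andP[/andP[dk _] _].
rewrite -scalerAl gintZ (gtail_hpoly (k := k)) ?mulr0 //.
exact: leq_trans sQ dk.
Qed.

(** Real and imaginary parts of (x + i y)^k, as polynomials in y. *)
Fixpoint cpow x k : {poly R} * {poly R} :=
  if k is k'.+1 then
    (x *: (cpow x k').1 - 'X * (cpow x k').2, x *: (cpow x k').2 + 'X * (cpow x k').1)
  else (1, 0).

Lemma cpow1S x k : (cpow x k.+1).1 = x *: (cpow x k).1 - 'X * (cpow x k).2.
Proof. by []. Qed.

Lemma cpow2S x k : (cpow x k.+1).2 = x *: (cpow x k).2 + 'X * (cpow x k).1.
Proof. by []. Qed.

Lemma cpowE x k y : ((x +i* y)%C ^+ k = (cpow x k).1.[y] +i* (cpow x k).2.[y])%C.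
Proof.
elim: k => [|k IH]; first by rewrite expr0 /= hornerC horner0.
rewrite exprS IH /= !hornerE.
by apply/eqP; rewrite eq_complex /= eqxx /= addrC eqxx.
Qed.

Lemma deriv_cpow x k : (cpow x k.+1).1^`() = - (k.+1%:R *: (cpow x k).2) /\
                       (cpow x k.+1).2^`() = k.+1%:R *: (cpow x k).1.
Proof.
elim: k => [|k [IH1 IH2]].
  by rewrite /= !(derivB, derivD, derivZ, derivC, derivM, derivX, deriv0); split;
     rewrite !(scaler0, mulr0, mulr1, subr0, oppr0, add0r, addr0, scale1r).
rewrite (cpow1S x k.+1) (cpow2S x k.+1) derivB derivD !derivZ !derivM !derivX.
rewrite IH1 IH2 mul1r (cpow1S x k) (cpow2S x k) -[k.+2%:R]natr1 !scalerDl !scale1r.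
by split; rewrite -!mul_polyC; ring.
Qed.

(** Integration by parts turns the recursion for the powers of x + i y into
    h_(k+2) = x h_(k+1) - (k+1) h_k, the recursion of the Hermite polynomials. *)
Lemma gint_cpow x k :
  gint (cpow x k).1 = (hpoly k).[x] * gint 1 /\ gint (cpow x k).2 = 0.
Proof.
suff : (gint (cpow x k).1 = (hpoly k).[x] * gint 1 /\ gint (cpow x k).2 = 0) /\
  (gint (cpow x k.+1).1 = (hpoly k.+1).[x] * gint 1 /\ gint (cpow x k.+1).2 = 0).
  by case.
elim: k => [|k [[a0 b0] [a1 b1]]].
  rewrite /= !mulr1 mulr0 derivC subr0 scaler0 subr0 add0r hornerC mul1r hornerX gint0.
  rewrite -['X]mulr1 gintZ gint_by_parts derivC gint0 //.
have [dA dB] := deriv_cpow x k.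
split=> //.
rewrite (cpow1S x k.+1) (cpow2S x k.+1).
rewrite gintB gintD !gintZ !gint_by_parts dA dB gintN !gintZ a0 b0 a1 b1.
rewrite !mulr0 oppr0 addr0; split => //.
rewrite (_ : hpoly k.+2 = 'X * hpoly k.+1 - (hpoly k.+1)^`()) // deriv_hpoly.
rewrite [in RHS]hornerD [in RHS]hornerN [in RHS]hornerM hornerX [in RHS]hornerZ.
ring.
Qed.

End HermitePolynomials.

(** * The standard Gaussian measure *)
Section StandardGaussian.
Context {R : realType}.
Local Notation mu := (@lebesgue_measure R).

Lemma normal_pdfE01 x : normal_pdf 0 1 x = (gint 1)^-1 * gpoly 2^-1 1 x :> R.
Proof.
have E y : normal_pdf 0 1 y = normal_peak 1 * gpoly 2^-1 1 y :> R.
  rewrite normal_pdfE // /gpoly /normal_fun hornerC mul1r subr0 expr1n.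
  by congr (_ * expR _); rewrite mulNr mulrC.
rewrite E; congr (_ * _).
have := @integral_normal_pdf R 0 1; under eq_integral do rewrite E.
move=> /(congr1 fine); rewrite -/(Rintegral _ _ _) RintegralZl //; last first.
  by apply: integrable_gpoly; rewrite invr_gt0.
have g0 : gint 1 != 0 :> R by rewrite gt_eqF // gint1_gt0.
by rewrite -/(gint 1) => H; apply: (mulIf g0); rewrite mulVf.
Qed.

(** The density of the Gaussian is a Radon-Nikodym derivative, hence almost
    everywhere equal to the one for which the change of variables is known. *)
Lemma ge0_integral_gamma1 (f : R -> R) : measurable_fun setT f -> (forall x, 0 <= f x) ->
  (\int[gamma1]_x (f x)%:E = \int[mu]_x (f x * normal_pdf 0 1 x)%:E)%E.
Proof.
move=> mf f0.
have dom : (@normal_prob R 0 1) `<< mu by exact: normal_prob_dominates.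
have mfE : measurable_fun setT (fun x => (f x)%:E) by exact/measurable_EFinP.
have f0E x : (0 <= (f x)%:E)%E by rewrite lee_fin.
have mpdf := @measurable_normal_pdf R 0 1.
pose g := Radon_Nikodym_SigmaFinite.f (@gamma1 R) mu.
have gi : mu.-integrable setT g by exact: Radon_Nikodym_SigmaFinite.f_integrable.
rewrite /gamma1 -(Radon_Nikodym_SigmaFinite.change_of_variables dom f0E measurableT mfE).
under [RHS]eq_integral do rewrite EFinM.
apply: ae_eq_integral => //.
- by apply: emeasurable_funM => //; exact: (measurable_int mu gi).
- by apply: emeasurable_funM => //; exact/measurable_EFinP.
- apply: ae_eqe_mul2l; apply: integral_ae_eq => //.
  + exact/measurable_EFinP.
  + by move=> E _ mE; rewrite -Radon_Nikodym_SigmaFinite.f_integral.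
Qed.

Lemma integral_gamma1 (f : R -> R) : measurable_fun setT f ->
  (\int[gamma1]_x (f x)%:E = \int[mu]_x (f x * normal_pdf 0 1 x)%:E)%E.
Proof.
move=> mf; rewrite [LHS]integralE [RHS]integralE.
have pE (h : R -> R) x : ((fun x => (h x)%:E)^\+ x = (Num.max (h x) 0)%:E)%E.
  by rewrite funeposE EFin_max.
have nE (h : R -> R) x : ((fun x => (h x)%:E)^\- x = (Num.max (- h x) 0)%:E)%E.
  by rewrite funenegE EFin_max.
have p0 x : 0 <= normal_pdf 0 1 x :> R by exact: normal_pdf_ge0.
congr (_ - _)%E.
- under eq_integral do rewrite pE.
  rewrite ge0_integral_gamma1; last 2 first.
  + by apply: measurable_maxr.
  + by move=> x; rewrite le_max lexx orbT.
  by apply: eq_integral => x _; rewrite pE maxr_pMl // mul0r.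
- under eq_integral do rewrite nE.
  rewrite ge0_integral_gamma1; last 2 first.
  + by apply: measurable_maxr => //; exact: measurableT_comp.
  + by move=> x; rewrite le_max lexx orbT.
  by apply: eq_integral => x _; rewrite nE maxr_pMl // mul0r mulNr.
Qed.

Lemma Rintegral_gamma1_horner (P : {poly R}) :
  \int[gamma1]_y P.[y] = gint P / gint 1.
Proof.
rewrite /Rintegral integral_gamma1; last by apply: measurable_continuous; exact: continuous_horner.
rewrite -/(Rintegral mu setT (fun x => P.[x] * normal_pdf 0 1 x)).
have half0 : 0 < 2^-1 :> R by rewrite invr_gt0.
rewrite mulrC /gint -RintegralZl //; last exact: integrable_gpoly.
apply: eq_Rintegral => x _; rewrite normal_pdfE01 /gpoly hornerC mul1r; ring.
Qed.

Lemma hermiteE k (x : R) : hermite k x = ((hpoly k).[x] +i* 0)%C.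
Proof.
have [a b] := gint_cpow x k; rewrite /hermite /gaussInt.
have g0 := @gint1_gt0 R.
congr (_ +i* _)%C.
- under eq_Rintegral do rewrite cpowE /=.
  by rewrite Rintegral_gamma1_horner a mulfK // gt_eqF.
- under eq_Rintegral do rewrite cpowE /=.
  by rewrite Rintegral_gamma1_horner b mul0r.
Qed.

End StandardGaussian.

(** * Complex polynomials *)
Section ComplexPolynomials.
Context {R : realType}.
Local Notation mu := (@lebesgue_measure R).
Local Notation normc := ComplexField.Normc.normc.
Implicit Types (A B : {poly R}) (p c x : R).

Definition cfun A B : R -> R[i] := fun x => (A.[x] +i* B.[x])%C.

Definition wnorm c A B x : R := normc (cfun A B x) * expR (- (c * x ^+ 2)).

Lemma normc_cfun A B x : normc (cfun A B x) = Num.sqrt (A.[x] ^+ 2 + B.[x] ^+ 2).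
Proof. by []. Qed.

Lemma normc_cfun_ge0 A B x : 0 <= normc (cfun A B x).
Proof. by rewrite normc_cfun sqrtr_ge0. Qed.

Lemma measurable_normc_cfun A B : measurable_fun setT (fun x => normc (cfun A B x)).
Proof.
apply: measurable_continuous => x.
apply: (@continuous_comp _ _ _ (fun x => A.[x] ^+ 2 + B.[x] ^+ 2) Num.sqrt); last first.
  exact: sqrt_continuous.
by apply: cvgD;
  [apply: (@continuous_comp _ _ _ (horner A) (fun u : R => u ^+ 2))
  |apply: (@continuous_comp _ _ _ (horner B) (fun u : R => u ^+ 2))];
  do ?[exact: continuous_horner|exact: exprn_continuous].
Qed.

Lemma measurable_wnorm c A B : measurable_fun setT (wnorm c A B).
Proof.
apply: measurable_funM; first exact: measurable_normc_cfun.
apply: (@eq_measurable_fun _ _ _ _ _ (gpoly c 1)); last exact: measurable_gpoly.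
by move=> x _; rewrite /gpoly hornerC mul1r.
Qed.

Lemma gaussLp_cfun p A B : 0 < p ->
  gaussLp p (cfun A B) =
    (((gint 1)^-1 `^ p^-1)%:E * Lp p (wnorm (2 * p)^-1 A B))%E.
Proof.
move=> p0; set c := (2 * p)^-1.
have g0 : 0 <= (gint 1)^-1 :> R by rewrite invr_ge0 ltW // gint1_gt0.
have mn := measurable_normc_cfun A B.
have mw := measurable_wnorm c A B.
rewrite /gaussLp unlock LpE.
have -> : (\int[gamma1]_x (`|(normc (cfun A B x))%:E| `^ p) =
    \int[gamma1]_x (`|normc (cfun A B x)| `^ p)%:E)%E by [].
rewrite ge0_integral_gamma1; last 2 first.
- exact: measurable_norm_powR.
- by move=> x; exact: powR_ge0.
rewrite (@eq_integral _ _ _ mu _ (fun x => ((gint 1)^-1%:E * (`|wnorm c A B x| `^ p)%:E)%E)); last first.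
  move=> x _; rewrite -EFinM normal_pdfE01; congr EFin.
  rewrite /wnorm normrM [`|expR _|]ger0_norm ?expR_ge0 // powRM ?expR_ge0 //.
  rewrite -expRM /gpoly hornerC mul1r.
  have -> : - (c * x ^+ 2) * p = - (2^-1 * x ^+ 2) by rewrite /c; field; rewrite gt_eqF.
  by ring.
rewrite ge0_integralZl ?lee_fin //; last first.
  by apply/measurable_EFinP; exact: measurable_norm_powR.
by rewrite poweRM ?lee_fin // integral_ge0.
Qed.

Lemma le_Re_wnorm c A B x : `|gpoly c A x| <= 1 * `|wnorm c A B x|.
Proof.
rewrite mul1r gpoly_norm /wnorm normrM [`|expR _|]ger0_norm ?expR_ge0 //.
rewrite ler_wpM2r ?expR_ge0 // ger0_norm ?normc_cfun_ge0 // normc_cfun.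
by rewrite -sqrtr_sqr ler_sqrt ?lerDl ?sqr_ge0 // addr_ge0 // sqr_ge0.
Qed.

Lemma le_Im_wnorm c A B x : `|gpoly c B x| <= 1 * `|wnorm c A B x|.
Proof.
rewrite mul1r gpoly_norm /wnorm normrM [`|expR _|]ger0_norm ?expR_ge0 //.
rewrite ler_wpM2r ?expR_ge0 // ger0_norm ?normc_cfun_ge0 // normc_cfun.
by rewrite -sqrtr_sqr ler_sqrt ?lerDr ?sqr_ge0 // addr_ge0 // sqr_ge0.
Qed.

Lemma wnorm_le c A B x :
  `|wnorm c A B x| <= 1 * `|gpoly c A x| + 1 * `|gpoly c B x|.
Proof.
rewrite !mul1r !gpoly_norm /wnorm normrM [`|expR _|]ger0_norm ?expR_ge0 // -mulrDl.
rewrite ler_wpM2r ?expR_ge0 // ger0_norm ?normc_cfun_ge0 // normc_cfun.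
have h : 0 <= `|A.[x]| + `|B.[x]| by rewrite addr_ge0.
rewrite -[leRHS]ger0_norm // -sqrtr_sqr ler_sqrt ?sqr_ge0 //.
rewrite -(real_normK (num_real A.[x])) -(real_normK (num_real B.[x])).
have := mulr_ge0 (normr_ge0 A.[x]) (normr_ge0 B.[x]); nra.
Qed.

Lemma Lp_complexify p c (K S : R) A B A' B' : 1 < p -> 0 <= K -> 0 <= S ->
  (K%:E * Lp p (gpoly c A) <= S%:E * Lp p (gpoly c A'))%E ->
  (K%:E * Lp p (gpoly c B) <= S%:E * Lp p (gpoly c B'))%E ->
  (K%:E * Lp p (wnorm c A B) <= (2 * S)%:E * Lp p (wnorm c A' B'))%E.
Proof.
move=> p1 K0 S0 HA HB; have p0 : 0 < p by exact: lt_trans p1.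
have N0 := Lp_ge0 p (wnorm c A' B').
have RA : (Lp p (gpoly c A') <= Lp p (wnorm c A' B'))%E.
  rewrite -[leRHS]mul1e; apply: Lp_le => //; first exact: measurable_gpoly.
    exact: measurable_wnorm.
  by move=> x; exact: le_Re_wnorm.
have RB : (Lp p (gpoly c B') <= Lp p (wnorm c A' B'))%E.
  rewrite -[leRHS]mul1e; apply: Lp_le => //; first exact: measurable_gpoly.
    exact: measurable_wnorm.
  by move=> x; exact: le_Im_wnorm.
apply: (@le_trans _ _ (K%:E * (1%:E * Lp p (gpoly c A) + 1%:E * Lp p (gpoly c B)))%E).
  apply: lee_wpmul2l => //; apply: Lp_triangle => //; try exact: measurable_gpoly.
  - exact: ltW.
  - exact: measurable_wnorm.
  - exact: wnorm_le.
rewrite !mul1e ge0_muleDr ?Lp_ge0 //.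
have -> : 2 * S = S + S by ring.
rewrite EFinD ge0_muleDl ?lee_fin //.
apply: leeD; first by apply: le_trans HA _; exact: lee_wpmul2l.
by apply: le_trans HB _; exact: lee_wpmul2l.
Qed.

Lemma derive1_horner A x : derive1 (horner A) x = A^`().[x].
Proof. by rewrite -derivE. Qed.

Lemma cderive_cfun A B : cderive (cfun A B) = cfun A^`() B^`().
Proof.
by apply/funext => x; rewrite /cderive /cfun /= !derive1_horner.
Qed.

Lemma ornstein_uhlenbeck_cfun A B : ornstein_uhlenbeck (cfun A B) =
  cfun (- gderiv 2^-1 A^`()) (- gderiv 2^-1 B^`()).
Proof.
apply/funext => x; rewrite /ornstein_uhlenbeck !cderive_cfun /cfun /gderiv mulfV // !scale1r.
rewrite !(hornerN, hornerD, hornerM, hornerX).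
by apply/eqP; rewrite eq_complex /=; apply/andP; split; apply/eqP; ring.
Qed.

Lemma hermite_tail_cfun d (f : R -> R[i]) : hermite_tail d f ->
  exists A B, [/\ f = cfun A B, gtail d A & gtail d B].
Proof.
move=> [n [a ->]].
exists (\sum_(d <= k < n) complex.Re (a k) *: hpoly k).
exists (\sum_(d <= k < n) complex.Im (a k) *: hpoly k).
split; [|exact: gtail_sum|exact: gtail_sum].
apply/funext => x; rewrite /cfun !horner_sum.
elim/big_rec3: _ => [//|k u v w _ ->].
rewrite hermiteE !hornerZ; case: (a k) => r s /=.
by apply/eqP; rewrite eq_complex /=; apply/andP; split; apply/eqP; ring.
Qed.

End ComplexPolynomials.

Theorem corollary2 (R : realType) (p : R) (hp : 1 < p) :
  exists S T : R, forall (d : nat) (hd : (1 <= d)%N) (f : R -> R[i]),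
    hermite_tail d f ->
    ((Num.sqrt (d%:R : R))%:E * gaussLp p f
       <= S%:E * gaussLp p (cderive f))%E /\
    ((d%:R : R)%:E * gaussLp p f
       <= T%:E * gaussLp p (ornstein_uhlenbeck f))%E.
Proof.
have p0 : 0 < p by exact: lt_trans hp.
have [S S0 HS] := favard_gradient hp.
have [T T0 HT] := favard_generator hp.
exists (2 * S), (2 * T) => d hd f /hermite_tail_cfun[A [B [-> HA HB]]].
rewrite cderive_cfun ornstein_uhlenbeck_cfun !gaussLp_cfun //.
have k0 : (0 <= ((gint 1)^-1 `^ p^-1)%:E :> \bar R)%E by rewrite lee_fin powR_ge0.
split; rewrite muleCA [leRHS]muleCA; apply: lee_wpmul2l => //; apply: Lp_complexify => //.
- exact: HS.
- exact: HS.
- apply: le_trans (HT d A hd HA) _; apply: lee_wpmul2l => //.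
  rewrite -[leRHS]mul1e; apply: Lp_le => //; try exact: measurable_gpoly.
  by move=> x; rewrite mul1r !gpoly_norm hornerN normrN.
- apply: le_trans (HT d B hd HB) _; apply: lee_wpmul2l => //.
  rewrite -[leRHS]mul1e; apply: Lp_le => //; try exact: measurable_gpoly.
  by move=> x; rewrite mul1r !gpoly_norm hornerN normrN.
Qed.
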